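(* Let $k\ge 0$, let $s$ be a side of an ideal pentagon of generation $k$ whose endpoints $\beta,\beta'$ lie in the 3rd sector and across which there lies an ideal pentagon $Q$ of generation $k+1$ with all vertices in the 3rd sector. Let $\beta,\delta_1,\delta_2,\delta_3,\beta'$ be the vertices of $Q$ listed in order along the arc from $\beta$ to $\beta'$. Let $(a,A)$ and $(b,B)$, with $a\le A$ and $b\le B$, be the pairs of periods of the directions $\beta$ and $\beta'$ respectively. Then the pairs of periods of the directions $\delta_1,\delta_2,\delta_3$ are, respectively, $$(b+A,\ a+A+B),\qquad (A+B,\ a+b+A+B),\qquad (a+B,\ b+A+B).$$ This holds both when ''period'' means the Arabic period (everywhere) and when it means the Roman period (everywhere).
   Context: Let $\phi=\frac{1+\sqrt5}{2}$. Let $P$ be a regular plane pentagon of side $1$ with a horizontal side at the bottom; label its sides, counterclockwise starting from the bottom side, by $3,5,2,4,1$. Let $P'=-P$ be its centrally symmetric copy; the side of $P'$ parallel to side $i$ of $P$ is also labelled $i$. The double pentagon $X$ is the flat surface obtained from $P\sqcup P'$ by gluing, for each $i$, the two sides labelled $i$ by a parallel translation. Directions of linear trajectories on $X$ are considered modulo $180^\circ$. The direction making angle $\theta$ (counterclockwise) with the horizontal is identified with the point $x=-\sin 36^\circ\cot\theta\in\mathbb{R}\cup\{\infty\}$. The 3rd sector is the set of directions $72^\circ\le\theta\le108^\circ$, i.e. $\frac{\phi}{2}-1\le x\le 1-\frac{\phi}{2}$. Regard $\mathbb{R}\cup\{\infty\}$ as the boundary at infinity of the hyperbolic plane. The ideal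 pentagon of generation $0$ has vertices $1-\frac{\phi}{2},\frac{\phi}{2},\infty,-\frac{\phi}{2},\frac{\phi}{2}-1$ (in cyclic order). The pentagons of generation $k+1$ are obtained from those of generation $k$ by reflecting each of them in its sides (for $k\ge1$, in its four sides not shared with a pentagon of generation $k-1$). All vertices of these pentagons are periodic directions: for such a direction $X$ decomposes into two strips of parallel closed trajectories. The symbolic orbit of a closed trajectory is the cyclic word in the symbols $1,\dots,5$ formed by the labels of the sides consecutively crossed in one traversal; it is the same for all trajectories of one strip. The Arabic period is the length of this word. For directions in the 3rd sector, this cyclic word splits into consecutive two-letter blocks, each of which is one of $43,41,25,23$; replacing them by ${\rm I},{\rm II},{\rm III},{\rm IV}$ respectively gives the Roman symbolic orbit, whose length is the Roman period (half of the Arabic one). The pair of periods of a periodic direction consists of the periods of its two strips, smaller one first. (The Roman periods for $x=\pm(1-\frac{\phi}{2})$ are all equal to 1.) *)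

(* Defs.v *)
From mathcomp Require Import all_boot all_order all_algebra.
From mathcomp Require Import all_classical all_reals all_analysis.

Set Implicit Arguments.
Unset Strict Implicit.
Unset Printing Implicit Defensive.

Import Order.TTheory GRing.Theory Num.Theory.
Local Open Scope ring_scope.
Local Open Scope classical_set_scope.

Section DoublePentagon.
Variable R : realType.

Definition unit_vector (theta : R) : 'rV[R]_2 :=
  \row_(i < 2) (if i == 0 then cos theta else sin theta).

(* The sides of P are indexed by 'I_5 counterclockwise from the bottom one.
   The position of P in the plane is irrelevant; its vertex number 0, the left
   end of the bottom side, is put at the origin. *)
Definition side_vector (i : 'I_5) : 'rV[R]_2 :=
  unit_vector (2 * pi * i%:R / 5).

Definition vertex (i : 'I_5) : 'rV[R]_2 :=
  \sum_(j < 5 | (j < i)%N) side_vector j.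

Definition label (i : 'I_5) : nat := nth 0%N [:: 3; 5; 2; 4; 1]%N i.

(* The point (i, t), 0 < t < 1, of side i of X, seen in P (b = false) or in
   P' = -P (b = true). The gluing translation preserves the vector
   [side_vector i] while -P reverses it, hence the 1 - t. *)
Definition side_point (b : bool) (i : 'I_5) (t : R) : 'rV[R]_2 :=
  if b then - (vertex i + (1 - t) *: side_vector i)
  else vertex i + t *: side_vector i.

(* (b, i, t): a trajectory crosses side i at the point (i, t) and enters the
   copy b of the pentagon (false for P, true for P'). *)
Definition crossing : Type := bool * 'I_5 * R.

(* Consecutive crossings of a trajectory traversed in the direction theta. The
   condition on t and t' keeps the trajectory away from the vertices. As the
   pentagon is strictly convex, the chord between relatively interior points of
   two different sides has no other point on the boundary. *)
Definition next_crossing (theta : R) (s s' : crossing) : Prop :=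
  let: (b, i, t) := s in
  let: (b', i', t') := s' in
  [/\ 0 < t < 1, 0 < t' < 1, b' = ~~ b, i != i' &
      exists2 l : R, 0 < l &
        side_point b i' t' - side_point b i t = l *: unit_vector theta].

(* The list of crossings of a closed trajectory in one traversal. *)
Definition closed_trajectory (theta : R) (c : seq crossing) : Prop :=
  [/\ c != [::], uniq c & cycle [rel s s' | `[< next_crossing theta s s' >]] c].

Definition on_closed_trajectory (theta : R) (s : crossing) : Prop :=
  exists2 c, closed_trajectory theta c & s \in c.

(* A strip is a maximal connected family of parallel closed trajectories. It is
   represented by the set of all crossings of its members: a closed trajectory
   may be followed, or moved to a parallel one by sliding its crossing with a
   side, as long as it remains a closed trajectory. *)
Inductive same_strip (theta : R) : crossing -> crossing -> Prop :=
| same_strip_follow c s s' of closed_trajectory theta c & s \in c & s' \in c :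
    same_strip theta s s'
| same_strip_slide b i t t' of
    (forall r, (t <= r <= t') || (t' <= r <= t) ->
       on_closed_trajectory theta (b, i, r)) :
    same_strip theta (b, i, t) (b, i, t')
| same_strip_trans s s' s'' of same_strip theta s s' & same_strip theta s' s'' :
    same_strip theta s s''.

Definition strip (theta : R) (S : set crossing) : Prop :=
  exists2 s, on_closed_trajectory theta s & S = [set s' | same_strip theta s s'].

(* X is the union of two strips, up to the trajectories that run into a
   vertex. *)
Definition two_strips (theta : R) (S1 S2 : set crossing) : Prop :=
  [/\ strip theta S1, strip theta S2, S1 <> S2 &
      forall s : nat -> crossing,
        (forall n, next_crossing theta (s n) (s n.+1)) ->
        S1 (s 0%N) \/ S2 (s 0%N)].

(* A representative of the cyclic word. *)
Definition symbolic_orbit (c : seq crossing) : seq nat :=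
  [seq label s.1.2 | s <- c].

Variant roman := RI | RII | RIII | RIV.

Definition roman_block (r : roman) : seq nat :=
  match r with
  | RI => [:: 4; 3] | RII => [:: 4; 1] | RIII => [:: 2; 5] | RIV => [:: 2; 3]
  end%N.

Definition roman_orbit (w : seq nat) (r : seq roman) : Prop :=
  exists m : nat, rot m w = flatten [seq roman_block x | x <- r].

Variant numeration := Arabic | Roman.

Definition word_period (num : numeration) (w : seq nat) (n : nat) : Prop :=
  match num with
  | Arabic => size w = n
  | Roman => exists2 r, roman_orbit w r & size r = n
  end.

Definition strip_period (num : numeration) (theta : R) (S : set crossing)
    (n : nat) : Prop :=
  exists c, [/\ closed_trajectory theta c, (forall s, s \in c -> S s) &
                word_period num (symbolic_orbit c) n].

(* R together with the point at infinity, which is None. *)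
Definition boundary : Type := option R.

Definition boundary_point (theta : R) : boundary :=
  if sin theta == 0 then None
  else Some (- (sin (pi / 5) * (cos theta / sin theta))).

(* The representative of a direction modulo pi is taken in [0, pi[, so that
   the trajectories are traversed upwards; the four Roman blocks presuppose
   this orientation. *)
Definition pair_of_periods (num : numeration) (x : boundary) (p q : nat) :
    Prop :=
  (p <= q)%N /\
  exists theta : R, [/\ 0 <= theta < pi, boundary_point theta = x &
    exists S1 S2, [/\ two_strips theta S1 S2, strip_period num theta S1 p &
                      strip_period num theta S2 q]].

Definition phi : R := (1 + Num.sqrt 5) / 2.

Definition third_sector (x : boundary) : Prop :=
  if x is Some y then phi / 2 - 1 <= y <= 1 - phi / 2 else False.

(* The action on the boundary of the hyperbolic reflection in the geodesic with
   the distinct ends p and q: the inversion in the circle having p and q as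
   diametrically opposite points, or a Euclidean reflection if one of them is
   infinite. *)
Definition reflection (p q x : boundary) : boundary :=
  match p, q with
  | Some u, Some v =>
      let m := (u + v) / 2 in
      if x is Some y then
        if y == m then None else Some (m + ((u - v) / 2) ^+ 2 / (y - m))
      else Some m
  | Some u, None | None, Some u => omap (fun y => 2 * u - y) x
  | None, None => x
  end.

(* An ideal pentagon is given by its vertices in cyclic order (in one of the
   two orientations). *)
Definition ideal_pentagon : Type := 5.-tuple boundary.

(* Side j joins the vertices number j and j + 1 mod 5. *)
Definition is_side (Q : ideal_pentagon) (j : 'I_5) (p q : boundary) : Prop :=
  (tnth Q j = p /\ tnth Q (ordS j) = q) \/
  (tnth Q j = q /\ tnth Q (ordS j) = p).

Definition reflect_pentagon (Q : ideal_pentagon) (j : 'I_5) : ideal_pentagon :=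
  map_tuple (reflection (tnth Q j) (tnth Q (ordS j))) Q.

Definition pentagon0 : ideal_pentagon :=
  [tuple Some (1 - phi / 2); Some (phi / 2); None; Some (- (phi / 2));
         Some (phi / 2 - 1)].

Fixpoint generation (k : nat) (Q : ideal_pentagon) : Prop :=
  match k with
  | 0 => Q = pentagon0
  | k1.+1 =>
      exists G (j : 'I_5), [/\ generation k1 G,
        match k1 with
        | 0 => True
        | k2.+1 => ~ exists F (i : 'I_5), generation k2 F /\
                       is_side F i (tnth G j) (tnth G (ordS j))
        end & Q = reflect_pentagon G j]
  end.

Definition listed_in_order (Q : ideal_pentagon) (l : seq boundary) : Prop :=
  exists n : nat, l = rot n Q \/ l = rev (rot n Q).

End DoublePentagon.

(* Main.v *)
Require Import Defs.
From mathcomp Require Import all_boot all_order all_algebra.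
From mathcomp Require Import all_classical all_reals all_analysis.
From mathcomp Require Import ring lra zify.

(** Let e and e' be the unit vectors at 72 and 108 degrees, the two ends of the
    third sector. Since 2 cos 36 = phi, the sides of the pentagons have
    coordinates in Z[phi] with respect to (e, e'), and the directions of the
    third sector are those of the vectors v = (p, q) with p, q >= 0.

    Trajectories of direction v return to the two lower sides of P' (labels 2
    and 4) by an exchange of four intervals of lengths q, phi q, phi p, p.
    Between two returns there are exactly two crossings, which form one Roman
    letter. Displacements in the plane will be measured in units of the diagonal
    phi; a visit to the four intervals then contributes e', phi e', phi e and e,
    respectively, to the displacement of a closed trajectory. As 1 and phi are
    independent over Q, this displacement determines how often the trajectory
    visits each interval, additively ([size_of_disp]): periods add up whenever
    displacements do.

    Now suppose that the closed trajectories of the two strips in direction v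
    have displacements v and phi v exactly; this is [decomposes v]. Let it hold
    for x and y, with pairs of periods (a, A) and (b, B), and for phi x + y,
    phi x + phi y and x + phi y. The shorter strip in direction phi x + y then
    has the displacement phi x of the longer strip of x plus the displacement y
    of the shorter strip of y, whence its period A + b; the longer one has
    phi (phi x + y) = x + phi x + phi y, whence a + A + B. The other two
    directions are similar ([pairs_of_periods_combine]).

    The property [decomposes] is obtained by renormalization. It is clear for
    v = e, where the exchange is the identity. It passes from v to its images
    under two linear maps, [shear] and [turn], because the exchange for the
    image of v induces the exchange for v on a suitable subinterval
    ([decomposes_shear], [decomposes_turn]); and it is invariant under the
    symmetry that swaps e and e'. Towers of the exchange become strips of the
    surface in [tower_same_strip] and [same_strip_in_tower].

    Finally, the hyperbolic reflection in the geodesic joining the directions of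
    x and y sends the direction of a x + b y to that of a x - b y
    ([reflection_bpoint]). Hence the vertices of any pentagon of the tessellation
    are the directions of x, phi x + y, phi x + phi y, x + phi y, y for some x
    and y (its [fan]), and the pentagon across the side joining two consecutive
    directions of a fan has the fan spanned by the corresponding two vectors
    ([framed_child]). In the third sector the spanning pairs are the images of
    (e, e'), up to order, under products of shears, turns and their mirror
    images ([nested_fan]), so that [decomposes] holds for all vectors of the fan of Q.
    For this Q must lie beyond G and not be the pentagon from which G was
    obtained: the generation of a pentagon can be read off its vertices
    ([framed_depth]). *)

Set Implicit Arguments.
Unset Strict Implicit.
Unset Printing Implicit Defensive.

Import Order.TTheory GRing.Theory Num.Theory.
Import numFieldNormedType.Exports.
Local Open Scope ring_scope.

(** * Interval exchanges and their towers *)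

(** Two pieces are moved to the right and two to the left; for the double
    pentagon, long and short are in the ratio phi. *)
Variant piece := Rshort | Rlong | Llong | Lshort.

Section IntervalExchange.
Variable R : realFieldType.
Implicit Types (len : piece -> R) (x l r : R) (w u : seq piece).

Definition width len : R := len Rshort + len Rlong + len Llong + len Lshort.

Definition on_piece len (L : piece) x : Prop :=
  match L with
  | Rshort => 0 < x < len Rshort
  | Rlong => len Rshort < x < len Rshort + len Rlong
  | Llong => len Rshort + len Rlong < x < len Rshort + len Rlong + len Llong
  | Lshort => len Rshort + len Rlong + len Llong < x < width len
  end.

(** The intervals come out in the order Llong, Rshort, Lshort, Rlong. *)
Definition shift len (L : piece) : R :=
  match L with
  | Rshort => len Llong
  | Rlong => len Llong + len Lshort
  | Llong => - (len Rshort + len Rlong)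
  | Lshort => - len Rlong
  end.

Definition shifts len w : R := \sum_(L <- w) shift len L.

Fixpoint follows len w x : Prop :=
  if w is L :: w' then on_piece len L x /\ follows len w' (x + shift len L)
  else True.

(** An orbit that never meets a discontinuity is spoken of through a set that
    contains it and is stable under the exchange. *)
Definition invariant len (S : R -> Prop) : Prop :=
  forall x, S x -> exists2 L, on_piece len L x & S (x + shift len L).

(** All the points of ]l, r[ follow the word w and are then back for the first
    time: it is the condition on prefixes that makes w describe one traversal. *)
Definition tower len w l r : Prop :=
  [/\ w <> [::], l < r, shifts len w = 0,
      (forall u v, w = u ++ v -> u <> [::] -> v <> [::] -> shifts len u <> 0) &
      forall x, l < x < r -> follows len w x].

(** Every orbit that avoids the discontinuities reaches B. *)
Definition covered_by len (B : R -> Prop) : Prop :=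
  forall S, invariant len S -> forall x, S x ->
  exists2 u, follows len u x & B (x + shifts len u).

Lemma shifts_nil len : shifts len [::] = 0.
Proof. by rewrite /shifts big_nil. Qed.

Lemma shifts_cons len L w : shifts len (L :: w) = shift len L + shifts len w.
Proof. by rewrite /shifts big_cons. Qed.

Lemma shifts_cat len u w : shifts len (u ++ w) = shifts len u + shifts len w.
Proof. by rewrite /shifts big_cat. Qed.

Lemma follows_cat len u w x :
  follows len (u ++ w) x <-> follows len u x /\ follows len w (x + shifts len u).
Proof.
elim: u x => [|L u IH] x /=; first by rewrite shifts_nil addr0; tauto.
by rewrite shifts_cons addrA IH; tauto.
Qed.

Definition nonneg len : Prop := forall L, 0 <= len L.

Lemma on_piece_range len L x : nonneg len -> on_piece len L x -> 0 < x < width len.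
Proof.
move=> ge0; move: (ge0 Rshort) (ge0 Rlong) (ge0 Llong) (ge0 Lshort).
by case: L; rewrite /= /width => *; lra.
Qed.

Lemma shift_range len L x : nonneg len -> on_piece len L x ->
  0 < x + shift len L < width len.
Proof.
move=> ge0; move: (ge0 Rshort) (ge0 Rlong) (ge0 Llong) (ge0 Lshort).
by case: L; rewrite /= /width => *; lra.
Qed.

Lemma on_piece_inj len L L' x : nonneg len ->
  on_piece len L x -> on_piece len L' x -> L = L'.
Proof.
move=> ge0; move: (ge0 Rshort) (ge0 Rlong) (ge0 Llong) (ge0 Lshort).
by case: L; case: L' => //=; rewrite /width => *; exfalso; lra.
Qed.

Lemma invariant_follows len S w x : nonneg len -> invariant len S -> S x ->
  follows len w x -> S (x + shifts len w).
Proof.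
move=> ge0 invS; elim: w x => [|L w IH] x Sx /=; first by rewrite shifts_nil addr0.
case=> onL fw; rewrite shifts_cons addrA; apply: IH => //.
by have [L' onL' SL'] := invS _ Sx; rewrite (on_piece_inj ge0 onL onL').
Qed.

(** The exchange [len1], translated by o, is the first return map of the
    exchange [len] to ]o, o + width len1[, and [sub L] is the itinerary of the
    piece L until its return. The last two hypotheses concern orbits that avoid
    the discontinuities of [len]: they visit the subinterval, and there they
    avoid the discontinuities of [len1] as well. *)
Section Renormalization.
Variables (len len1 : piece -> R) (sub : piece -> seq piece) (o : R).
Hypothesis ge0 : nonneg len.
Hypothesis ge01 : nonneg len1.
Hypothesis sub_neq0 : forall L, sub L <> [::].
Hypothesis sub_follows : forall L x, on_piece len1 L x -> follows len (sub L) (o + x).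
Hypothesis sub_shifts : forall L, shifts len (sub L) = shift len1 L.
Hypothesis sub_first : forall L x n, on_piece len1 L x -> (0 < n < size (sub L))%N ->
  ~ (o < o + x + shifts len (take n (sub L)) < o + width len1).
Hypothesis sub_visit : forall S, invariant len S -> forall x, S x ->
  exists2 u, follows len u x & o < x + shifts len u < o + width len1.
Hypothesis sub_invariant : forall S, invariant len S -> forall x, S (o + x) ->
  0 < x < width len1 -> exists L, on_piece len1 L x.

Definition subst w := flatten [seq sub L | L <- w].

Lemma subst_shifts w : shifts len (subst w) = shifts len1 w.
Proof.
rewrite /subst; elim: w => [|L w IH] /=; first by rewrite !shifts_nil.
by rewrite shifts_cat IH sub_shifts shifts_cons.
Qed.

Lemma subst_follows w x : follows len1 w x -> follows len (subst w) (o + x).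
Proof.
rewrite /subst; elim: w x => [|L w IH] x //= [onL fw].
rewrite follows_cat sub_shifts; split; first exact: sub_follows.
by rewrite -addrA; exact: IH.
Qed.

Lemma subst_prefix w u v : subst w = u ++ v -> v <> [::] ->
  exists w1 L w2 u1 v1, [/\ w = w1 ++ L :: w2, u = subst w1 ++ u1,
                            sub L = u1 ++ v1 & v1 <> [::]].
Proof.
rewrite /subst; elim: w u v => [|L w IH] u v /= e v0.
  by case: u e; case: v v0.
have [lt_s|ge_s] := ltnP (size u) (size (sub L)).
  exists [::], L, w, u, (drop (size u) (sub L)); split => //.
    have := congr1 (take (size u)) e.
    rewrite (take_size_cat v (erefl (size u))) takel_cat 1?ltnW // => eu.
    by rewrite -{1}eu cat_take_drop.
  by move=> /(congr1 size) /eqP; rewrite size_drop /= subn_eq0 leqNgt lt_s.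
have eu : u = sub L ++ drop (size (sub L)) u.
  have := congr1 (take (size (sub L))) e.
  rewrite (take_size_cat _ (erefl (size (sub L)))) takel_cat // => eu.
  by rewrite {1}eu cat_take_drop.
have e' : flatten [seq sub L | L <- w] = drop (size (sub L)) u ++ v.
  have := congr1 (drop (size (sub L))) e.
  rewrite (drop_size_cat _ (erefl (size (sub L)))) => ->.
  by rewrite {1}eu -catA (drop_size_cat _ (erefl (size (sub L)))).
have [w1 [L' [w2 [u1 [v1 [-> eu1 eL' v10]]]]]] := IH _ _ e' v0.
by exists (L :: w1), L', w2, u1, v1; split => //=; rewrite {1}eu eu1 catA.
Qed.

(** A proper prefix of [subst w] either ends at the end of a block, where the
    points are back only if w allows it, or inside a block, where they are
    outside the subinterval because each block is a first return. *)
Lemma tower_subst w l r : tower len1 w l r -> tower len (subst w) (o + l) (o + r).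
Proof.
move=> [w0 lt_lr w_shifts prim fol]; split.
- by case: w w0 {w_shifts prim fol} => //= L w _; rewrite /subst /=; have := @sub_neq0 L; case: (sub L).
- by rewrite ltrD2l.
- by rewrite subst_shifts.
- move=> u v e u0 v0 su.
  have [w1 [L [w2 [u1 [v1 [ew eu eL v10]]]]]] := subst_prefix e v0.
  have x_in : l < (l + r) / 2 < r by lra.
  have := fol _ x_in; rewrite ew follows_cat => -[fw1 [/= onL _]].
  move: su; rewrite eu shifts_cat subst_shifts => su.
  have [u10|u10] := eqVneq (size u1) 0%N.
    move: su eu; rewrite (size0nil u10) shifts_nil addr0 cats0 => su eu.
    by apply: (prim w1 (L :: w2)) => // w10; apply: u0; rewrite eu w10.
  have n_in : (0 < size u1 < size (sub L))%N.
    by rewrite lt0n u10 eL size_cat -addn1 leq_add2l; case: (v1) v10.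
  apply: (sub_first onL n_in); rewrite eL take_size_cat //.
  have {su} -> : o + ((l + r) / 2 + shifts len1 w1) + shifts len u1 = o + (l + r) / 2.
    by rewrite -!addrA su addr0.
  case: w w0 fol {e ew prim w_shifts} => // L' w' _ fol.
  by case: (fol _ x_in) => /(on_piece_range ge01) ? _; lra.
- move=> x x_in; have -> : x = o + (x - o) by ring.
  by apply: subst_follows; apply: fol; lra.
Qed.

Lemma covered_subst (B B1 : R -> Prop) : (forall x, B1 x -> B (o + x)) ->
  covered_by len1 B1 -> covered_by len B.
Proof.
move=> BB cov S invS x Sx.
have [u fu u_in] := sub_visit invS Sx.
pose S1 y := S (o + y) /\ 0 < y < width len1.
have invS1 : invariant len1 S1.
  move=> y [Sy y_in]; have [L onL] := sub_invariant invS Sy y_in.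
  exists L => //; split; last exact: (shift_range ge01 onL).
  by rewrite addrA -sub_shifts; apply: invariant_follows (sub_follows onL).
pose y := x + shifts len u - o.
have S1y : S1 y.
  split; last by rewrite /y; lra.
  rewrite /y; have -> : o + (x + shifts len u - o) = x + shifts len u by ring.
  exact: invariant_follows fu.
have [w fw Bw] := cov _ invS1 _ S1y.
exists (u ++ subst w).
  rewrite follows_cat; split => //.
  have -> : x + shifts len u = o + y by rewrite /y; ring.
  exact: subst_follows.
rewrite shifts_cat subst_shifts addrA.
have -> : x + shifts len u + shifts len1 w = o + (y + shifts len1 w) by rewrite /y; ring.
exact: BB.
Qed.

End Renormalization.
End IntervalExchange.

(** * Two renormalizations *)

Section GoldenRenormalization.
Variable R : realFieldType.
Implicit Types (len : piece -> R) (x l r : R) (w u : seq piece).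

(** Return itineraries. The shear fixes e, and is the renormalization of the
    parabolic automorphism of the surface that fixes this end of the sector. *)
Definition sub_shear (L : piece) : seq piece :=
  match L with
  | Rshort => [:: Llong; Rshort] | Rlong => [:: Llong; Rlong; Lshort]
  | Llong => [:: Llong] | Lshort => [:: Lshort]
  end.

Definition sub_turn (L : piece) : seq piece :=
  match L with
  | Rshort => [:: Rlong; Llong] | Rlong => [:: Rlong; Lshort; Llong; Rshort]
  | Llong => [:: Rlong; Lshort; Llong] | Lshort => [:: Llong; Rshort]
  end.

Ltac simpl_shifts := rewrite /= /shifts /= ?big_cons ?big_nil /=.

Section Shear.
Variables (len len1 : piece -> R).
Hypothesis ge0 : nonneg len1.
Hypothesis eA : len Rshort = len1 Rshort.
Hypothesis eB : len Rlong = len1 Rlong.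
Hypothesis eC : len Llong = len1 Llong + (len1 Rshort + len1 Rlong).
Hypothesis eD : len Lshort = len1 Lshort + len1 Rlong.

Lemma sub_shear_follows L x : on_piece len1 L x ->
  follows len (sub_shear L) (len1 Rshort + len1 Rlong + x).
Proof.
move: (ge0 Rshort) (ge0 Rlong) (ge0 Llong) (ge0 Lshort).
by case: L => /=; rewrite /width ?eA ?eB ?eC ?eD => *; repeat split; lra.
Qed.

Lemma sub_shear_shifts L : shifts len (sub_shear L) = shift len1 L.
Proof. by case: L; simpl_shifts; rewrite ?eA ?eB ?eC ?eD; ring. Qed.

Lemma sub_shear_first L x n : on_piece len1 L x -> (0 < n < size (sub_shear L))%N ->
  let o := len1 Rshort + len1 Rlong in
  ~ (o < o + x + shifts len (take n (sub_shear L)) < o + width len1).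
Proof.
move: (ge0 Rshort) (ge0 Rlong) (ge0 Llong) (ge0 Lshort).
case: L => ? ? ? ?; case: n => [|[|[|n]]] //= onL _; simpl_shifts;
  rewrite ?eA ?eB ?eC ?eD /width => ?; lra.
Qed.

Lemma sub_shear_visit S : invariant len S -> forall x, S x ->
  let o := len1 Rshort + len1 Rlong in
  exists2 u, follows len u x & o < x + shifts len u < o + width len1.
Proof.
move: (ge0 Rshort) (ge0 Rlong) (ge0 Llong) (ge0 Lshort) => ? ? ? ? invS x Sx /=.
have [] := invS x Sx; case=> /=; rewrite /width ?eA ?eB ?eC ?eD => ? Sx1.
- by exists [:: Rshort]; simpl_shifts; rewrite ?eA ?eB ?eC ?eD; [split|]; lra.
- by exists [:: Rlong; Lshort]; simpl_shifts; rewrite /width ?eA ?eB ?eC ?eD;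
    [repeat split|]; lra.
- by exists [::]; simpl_shifts; lra.
- have [lt|ge] := ltP x (len1 Rshort + len1 Rlong +
    (len1 Rshort + len1 Rlong + len1 Llong + len1 Lshort)).
    by exists [::]; simpl_shifts; lra.
  by exists [:: Lshort]; simpl_shifts; rewrite /width ?eA ?eB ?eC ?eD; [split|]; lra.
Qed.

(** Within two steps, an orbit that meets an end of a piece of the induced
    exchange meets an end of a piece of the original one. *)
Lemma sub_shear_invariant S : invariant len S -> forall x,
  S (len1 Rshort + len1 Rlong + x) -> 0 < x < width len1 ->
  exists L, on_piece len1 L x.
Proof.
move: (ge0 Rshort) (ge0 Rlong) (ge0 Llong) (ge0 Lshort) => ? ? ? ? invS x Sx.
rewrite /width => x_in.
have step y : S y -> exists2 L, on_piece len L y & S (y + shift len L) by exact: invS.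
case: (ltgtP x (len1 Rshort)) => [?|?|e1]; first by exists Rshort => /=; lra.
- case: (ltgtP x (len1 Rshort + len1 Rlong)) => [?|?|e1]; first by exists Rlong => /=; lra.
    case: (ltgtP x (len1 Rshort + len1 Rlong + len1 Llong)) => [?|?|e1].
    + by exists Llong => /=; lra.
    + by exists Lshort => /=; rewrite /width; lra.
    + exfalso; case: (step _ Sx) => -[] /=; rewrite /width ?eA ?eB ?eC ?eD => *; lra.
  exfalso; case: (step _ Sx) => -[] /=; rewrite /width ?eA ?eB ?eC ?eD => ? Sy; try lra;
  case: (step _ Sy) => -[] /=; rewrite /width ?eA ?eB ?eC ?eD => *; lra.
- exfalso; case: (step _ Sx) => -[] /=; rewrite /width ?eA ?eB ?eC ?eD => ? Sy; try lra;
  case: (step _ Sy) => -[] /=; rewrite /width ?eA ?eB ?eC ?eD => *; lra.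
Qed.

Lemma shear_ge0 : nonneg len.
Proof.
move: (ge0 Rshort) (ge0 Rlong) (ge0 Llong) (ge0 Lshort) => ? ? ? ?.
by case; rewrite ?eA ?eB ?eC ?eD; lra.
Qed.

End Shear.

Section Turn.
Variables (len len1 : piece -> R).
Hypothesis ge0 : nonneg len1.
Hypothesis eA : len Rshort = len1 Rlong + len1 Lshort.
Hypothesis eB : len Rlong = len1 Rshort + len1 Rlong + len1 Llong.
Hypothesis eC : len Llong = len1 Rshort + len1 Rlong + len1 Llong + len1 Lshort.
Hypothesis eD : len Lshort = len1 Rlong + len1 Llong.

Lemma sub_turn_follows L x : on_piece len1 L x ->
  follows len (sub_turn L) (len1 Rlong + len1 Lshort + x).
Proof.
move: (ge0 Rshort) (ge0 Rlong) (ge0 Llong) (ge0 Lshort).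
by case: L => /=; rewrite /width ?eA ?eB ?eC ?eD => *; repeat split; lra.
Qed.

Lemma sub_turn_shifts L : shifts len (sub_turn L) = shift len1 L.
Proof. by case: L; simpl_shifts; rewrite ?eA ?eB ?eC ?eD; ring. Qed.

Lemma sub_turn_first L x n : on_piece len1 L x -> (0 < n < size (sub_turn L))%N ->
  let o := len1 Rlong + len1 Lshort in
  ~ (o < o + x + shifts len (take n (sub_turn L)) < o + width len1).
Proof.
move: (ge0 Rshort) (ge0 Rlong) (ge0 Llong) (ge0 Lshort).
case: L => ? ? ? ?; case: n => [|[|[|[|n]]]] //= onL _; simpl_shifts;
  move: onL; rewrite ?eA ?eB ?eC ?eD /width => *; lra.
Qed.

Lemma sub_turn_visit S : invariant len S -> forall x, S x ->
  let o := len1 Rlong + len1 Lshort in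
  exists2 u, follows len u x & o < x + shifts len u < o + width len1.
Proof.
move: (ge0 Rshort) (ge0 Rlong) (ge0 Llong) (ge0 Lshort) => ? ? ? ? invS x Sx /=.
have step y : S y -> exists2 L, on_piece len L y & S (y + shift len L) by exact: invS.
have goC y : S y -> on_piece len Llong y -> exists2 u, follows len u y &
    len1 Rlong + len1 Lshort < y + shifts len u <
    len1 Rlong + len1 Lshort + width len1.
  rewrite /= /width ?eA ?eB ?eC ?eD => Sy y_in.
  have [] := step y Sy; case=> /=; rewrite /width ?eA ?eB ?eC ?eD => ? Sy1; try lra.
  have [] := step _ Sy1; case=> /=; rewrite /width ?eA ?eB ?eC ?eD => ? Sy2; try lra.
  - by exists [:: Llong; Rshort]; simpl_shifts; rewrite /width ?eA ?eB ?eC ?eD;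
      [repeat split|]; lra.
  - by exists [:: Llong]; simpl_shifts; rewrite /width ?eA ?eB ?eC ?eD;
      [repeat split|]; lra.
have [] := step x Sx; case=> /=; rewrite /width ?eA ?eB ?eC ?eD => ? Sx1.
- by exists [:: Rshort]; simpl_shifts; rewrite ?eA ?eB ?eC ?eD; [split|]; lra.
- by exists [::]; simpl_shifts; lra.
- by apply: goC => //=; rewrite ?eA ?eB ?eC ?eD.
- have [|u fu u_in] := goC _ Sx1.
    by rewrite /= ?eA ?eB ?eC ?eD; lra.
  exists (Lshort :: u); last by rewrite shifts_cons addrA /= eB; apply: u_in.
  by split => /=; rewrite /width ?eA ?eB ?eC ?eD //; lra.
Qed.

Lemma sub_turn_invariant S : invariant len S -> forall x,
  S (len1 Rlong + len1 Lshort + x) -> 0 < x < width len1 ->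
  exists L, on_piece len1 L x.
Proof.
move: (ge0 Rshort) (ge0 Rlong) (ge0 Llong) (ge0 Lshort) => ? ? ? ? invS x Sx.
rewrite /width => x_in.
have step y : S y -> exists2 L, on_piece len L y & S (y + shift len L) by exact: invS.
case: (ltgtP x (len1 Rshort)) => [?|?|e1]; first by exists Rshort => /=; lra.
- case: (ltgtP x (len1 Rshort + len1 Rlong)) => [?|?|e1]; first by exists Rlong => /=; lra.
    case: (ltgtP x (len1 Rshort + len1 Rlong + len1 Llong)) => [?|?|e1].
    + by exists Llong => /=; lra.
    + by exists Lshort => /=; rewrite /width; lra.
    + exfalso; case: (step _ Sx) => -[] /=; rewrite /width ?eA ?eB ?eC ?eD => *; lra.
  exfalso; case: (step _ Sx) => -[] /=; rewrite /width ?eA ?eB ?eC ?eD => ? Sy; try lra;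
  case: (step _ Sy) => -[] /=; rewrite /width ?eA ?eB ?eC ?eD => ? Sz; try lra;
  case: (step _ Sz) => -[] /=; rewrite /width ?eA ?eB ?eC ?eD => ? Sw; try lra;
  case: (step _ Sw) => -[] /=; rewrite /width ?eA ?eB ?eC ?eD => *; lra.
- exfalso; case: (step _ Sx) => -[] /=; rewrite /width ?eA ?eB ?eC ?eD => ? Sy; try lra;
  case: (step _ Sy) => -[] /=; rewrite /width ?eA ?eB ?eC ?eD => *; lra.
Qed.

Lemma turn_ge0 : nonneg len.
Proof.
move: (ge0 Rshort) (ge0 Rlong) (ge0 Llong) (ge0 Lshort) => ? ? ? ?.
by case; rewrite ?eA ?eB ?eC ?eD; lra.
Qed.

End Turn.
End GoldenRenormalization.

(** * Decomposition of a direction into two towers *)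

(** Reversing the interval conjugates the exchange for (p, q) to that for
    (q, p); on the surface this is the reflection that swaps e and e'. *)
Definition mirror (L : piece) : piece :=
  match L with
  | Rshort => Lshort | Rlong => Llong | Llong => Rlong | Lshort => Rshort
  end.

Section Directions.
Variable R : realFieldType.
Implicit Types (len : piece -> R) (x l r : R) (w u : seq piece).

Section Mirror.
Variables (len len' : piece -> R).
Hypothesis len'E : forall L, len' (mirror L) = len L.

Lemma mirror_on_piece L x : on_piece len L x -> on_piece len' (mirror L) (width len - x).
Proof.
move: (len'E Rshort) (len'E Rlong) (len'E Llong) (len'E Lshort) => /= e1 e2 e3 e4.
by case: L => /=; rewrite /width ?e1 ?e2 ?e3 ?e4; lra.
Qed.

Lemma mirror_shift L : shift len' (mirror L) = - shift len L.
Proof.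
move: (len'E Rshort) (len'E Rlong) (len'E Llong) (len'E Lshort) => /= e1 e2 e3 e4.
by case: L => /=; rewrite ?e1 ?e2 ?e3 ?e4; lra.
Qed.

Lemma mirror_shifts w : shifts len' (map mirror w) = - shifts len w.
Proof.
elim: w => [|L w IH] /=; first by rewrite !shifts_nil oppr0.
by rewrite !shifts_cons IH mirror_shift opprD.
Qed.

Lemma mirror_follows w x : follows len w x -> follows len' (map mirror w) (width len - x).
Proof.
elim: w x => [|L w IH] x //= [onL fw]; split; first exact: mirror_on_piece.
by rewrite mirror_shift -addrA -opprD; exact: IH.
Qed.

Lemma tower_mirror w l r : tower len w l r ->
  tower len' (map mirror w) (width len - r) (width len - l).
Proof.
move=> [w0 lr sw prim fol]; split.
- by case: w w0 {sw prim fol}.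
- by rewrite ltrD2l ltrN2.
- by rewrite mirror_shifts sw oppr0.
- move=> u v e u0 v0.
  have eu : u = map mirror (take (size u) w) by rewrite map_take e take_size_cat.
  have ev : v = map mirror (drop (size u) w) by rewrite map_drop e drop_size_cat.
  rewrite eu mirror_shifts => /eqP; rewrite oppr_eq0 => /eqP; apply: prim (esym (cat_take_drop _ _)) _ _.
  + by move=> e0; apply: u0; rewrite eu e0.
  + by move=> e0; apply: v0; rewrite ev e0.
- move=> x x_in; have -> : x = width len - (width len - x) by ring.
  by apply: mirror_follows; apply: fol; lra.
Qed.

Lemma covered_mirror (B B' : R -> Prop) : (forall x, B x -> B' (width len - x)) ->
  covered_by len B -> covered_by len' B'.
Proof.
move=> BB cov S invS x Sx.
have inv' : invariant len (fun y => S (width len - y)).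
  move=> y /invS [L onL SL].
  have len_E L' : len (mirror L') = len' L' by case: L'; rewrite -len'E.
  have shiftE : shift len (mirror L) = - shift len' L.
    by rewrite -[LHS]opprK -(mirror_shift (mirror L)); case: (L).
  exists (mirror L).
    move: onL (len_E Rshort) (len_E Rlong) (len_E Llong) (len_E Lshort) => /= + e1 e2 e3 e4.
    by case: (L) => /=; rewrite /width ?e1 ?e2 ?e3 ?e4; lra.
  by rewrite shiftE opprD opprK addrA.
have Sx' : S (width len - (width len - x)) by rewrite subKr.
have [u fu Bu] := cov _ inv' _ Sx'.
exists (map mirror u).
  by have := mirror_follows fu; rewrite subKr.
rewrite mirror_shifts.
have -> : x - shifts len u = width len - (width len - x + shifts len u) by ring.
exact: BB.
Qed.
End Mirror.

Variable f : R.
Hypothesis f_gt0 : 0 < f.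
Hypothesis ff : f * f = f + 1.

(** The widths of the four beams of direction v in which trajectories move in
    parallel from the lower sides of P' back to them. *)
Definition lengths (v : R * R) (L : piece) : R :=
  match L with
  | Rshort => v.2 | Rlong => f * v.2 | Llong => f * v.1 | Lshort => v.1
  end.

(** The displacement in the plane of a closed trajectory whose returns are coded
    by w, in the basis (phi e, phi e'). The closed trajectories parallel to e have
    lengths phi and phi ^ 2, so this basis makes the displacement of the shorter
    ones equal to their direction v. *)
Definition disp w : R * R :=
  (\sum_(L <- w) match L with Llong => f | Lshort => 1 | _ => 0 end,
   \sum_(L <- w) match L with Rshort => 1 | Rlong => f | _ => 0 end).

Record two_towers (v : R * R) w1 (l1 r1 : R) w2 (l2 r2 : R) : Prop := TwoTowers {
  short_tower : tower (lengths v) w1 l1 r1;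
  long_tower : tower (lengths v) w2 l2 r2;
  short_disp : disp w1 = v;
  long_disp : disp w2 = (f * v.1, f * v.2);
  towers_cover : covered_by (lengths v) (fun x => l1 < x < r1 \/ l2 < x < r2)
}.

Definition decomposes (v : R * R) : Prop :=
  exists w1 l1 r1 w2 l2 r2, two_towers v w1 l1 r1 w2 l2 r2.

Definition shear (v : R * R) : R * R := (v.1 + f * v.2, v.2).
Definition turn (v : R * R) : R * R := (f * v.1 + f * v.2, v.1 + f * v.2).
Definition swap (v : R * R) : R * R := (v.2, v.1).

Lemma disp_nil : disp [::] = (0, 0).
Proof. by rewrite /disp !big_nil. Qed.

Lemma disp_cat u w : disp (u ++ w) = ((disp u).1 + (disp w).1, (disp u).2 + (disp w).2).
Proof. by rewrite /disp !big_cat. Qed.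

(** Induction does not change trajectories but only shortens their coding, so
    displacements are transformed by the same linear map as the direction. *)
Lemma disp_subst (sub : piece -> seq piece) (M : R * R -> R * R) :
  (forall a b : R * R,
     M (a.1 + b.1, a.2 + b.2) = ((M a).1 + (M b).1, (M a).2 + (M b).2)) ->
  (forall L, disp (sub L) = M (disp [:: L])) ->
  forall w, disp (subst sub w) = M (disp w).
Proof.
move=> MD Msub; rewrite /subst.
have M0 : M (0, 0) = (0, 0).
  have := MD (0, 0) (0, 0); rewrite /= !addr0; case: (M _) => a b [ea eb].
  by congr pair; lra.
elim=> [|L w IH] /=; first by rewrite disp_nil M0.
by rewrite disp_cat IH Msub -MD -disp_cat.
Qed.

Lemma lengths_ge0 v : 0 <= v.1 -> 0 <= v.2 -> nonneg (lengths v).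
Proof. by move=> v1 v2; case=> //=; rewrite mulr_ge0 // ltW. Qed.

(** The conditions of the renormalization are linear in the lengths; the
    equation of the golden ratio is what makes the induced exchange again one
    with lengths of the form q, phi q, phi p, p. *)
Lemma decomposes_shear v : 0 <= v.1 -> 0 <= v.2 -> decomposes v -> decomposes (shear v).
Proof.
move=> v1 v2 [w1 [l1 [r1 [w2 [l2 [r2 [t1 t2 d1 d2 cov]]]]]]].
have ge0 := lengths_ge0 v1 v2.
have eA : lengths (shear v) Rshort = lengths v Rshort by [].
have eB : lengths (shear v) Rlong = lengths v Rlong by [].
have eC : lengths (shear v) Llong = lengths v Llong + (lengths v Rshort + lengths v Rlong).
  by rewrite /= mulrDr mulrA ff; ring.
have eD : lengths (shear v) Lshort = lengths v Lshort + lengths v Rlong by [].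
have ge0' := shear_ge0 ge0 eA eB eC eD.
have sub0 L : sub_shear L <> [::] by case: L.
have dispE : forall w, disp (subst sub_shear w) = shear (disp w).
  by apply: disp_subst => [u u'|[]]; rewrite /shear /disp /= ?(big_cons, big_nil) /=;
    congr pair; ring: ff.
pose o := lengths v Rshort + lengths v Rlong.
have H1 := sub_shear_follows ge0 eA eB eC eD.
have H2 := sub_shear_shifts eA eB eC eD.
have H3 := sub_shear_first ge0 eA eB eC eD.
exists (subst sub_shear w1), (o + l1), (o + r1), (subst sub_shear w2), (o + l2), (o + r2).
split.
- exact: tower_subst t1.
- exact: tower_subst t2.
- by rewrite dispE d1.
- by rewrite dispE d2 /shear /=; congr pair; ring.
- have H4 := sub_shear_visit ge0 eA eB eC eD.
  have H5 := sub_shear_invariant ge0 eA eB eC eD.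
  apply: (covered_subst ge0' ge0 H1 H2 H4 H5 _ cov).
  by rewrite {}/o => x /= [] ?; [left|right]; lra.
Qed.

Lemma decomposes_turn v : 0 <= v.1 -> 0 <= v.2 -> decomposes v -> decomposes (turn v).
Proof.
move=> v1 v2 [w1 [l1 [r1 [w2 [l2 [r2 [t1 t2 d1 d2 cov]]]]]]].
have ge0 := lengths_ge0 v1 v2.
have eA : lengths (turn v) Rshort = lengths v Rlong + lengths v Lshort by rewrite /= addrC.
have eB : lengths (turn v) Rlong = lengths v Rshort + lengths v Rlong + lengths v Llong.
  by rewrite /= mulrDr mulrA ff; ring.
have eC : lengths (turn v) Llong = lengths v Rshort + lengths v Rlong + lengths v Llong + lengths v Lshort.
  by rewrite /= mulrDr !mulrA ff; ring.
have eD : lengths (turn v) Lshort = lengths v Rlong + lengths v Llong by rewrite /= addrC.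
have ge0' := turn_ge0 ge0 eA eB eC eD.
have sub0 L : sub_turn L <> [::] by case: L.
have dispE : forall w, disp (subst sub_turn w) = turn (disp w).
  by apply: disp_subst => [u u'|[]]; rewrite /turn /disp /= ?(big_cons, big_nil) /=;
    congr pair; ring: ff.
pose o := lengths v Rlong + lengths v Lshort.
have H1 := sub_turn_follows ge0 eA eB eC eD.
have H2 := sub_turn_shifts eA eB eC eD.
have H3 := sub_turn_first ge0 eA eB eC eD.
exists (subst sub_turn w1), (o + l1), (o + r1), (subst sub_turn w2), (o + l2), (o + r2).
split.
- exact: tower_subst t1.
- exact: tower_subst t2.
- by rewrite dispE d1.
- by rewrite dispE d2 /turn /=; congr pair; ring.
- have H4 := sub_turn_visit ge0 eA eB eC eD.
  have H5 := sub_turn_invariant ge0 eA eB eC eD.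
  apply: (covered_subst ge0' ge0 H1 H2 H4 H5 _ cov).
  by rewrite {}/o => x /= [] ?; [left|right]; lra.
Qed.

Lemma decomposes_swap v : decomposes v -> decomposes (swap v).
Proof.
move=> [w1 [l1 [r1 [w2 [l2 [r2 [t1 t2 d1 d2 cov]]]]]]].
have lenE L : lengths (swap v) (mirror L) = lengths v L by case: L.
have dispE w : disp (map mirror w) = swap (disp w).
  elim: w => [|L w IH]; first by rewrite disp_nil.
  rewrite -cat1s map_cat !disp_cat IH /swap /=.
  by rewrite /disp /= !big_cons !big_nil /=; case: (L).
exists (map mirror w1), (width (lengths v) - r1), (width (lengths v) - l1).
exists (map mirror w2), (width (lengths v) - r2), (width (lengths v) - l2).
split.
- exact: tower_mirror t1.
- exact: tower_mirror t2.
- by rewrite dispE d1.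
- by rewrite dispE d2.
- apply: (covered_mirror lenE _ cov).
  by move=> x /= [] ?; [left|right]; lra.
Qed.

(** In direction e only the left pieces have a positive length, and the exchange
    does not move them. *)
Lemma decomposes_base : decomposes (1, 0).
Proof.
have tow L l r : (forall x, l < x < r -> on_piece (lengths (1, 0)) L x) ->
    shift (lengths (1, 0)) L = 0 -> l < r -> tower (lengths (1, 0)) [:: L] l r.
  move=> onL s0 lr; split => //.
  - by rewrite shifts_cons s0 shifts_nil addr0.
  - by case=> [|? [|]] // [].
  - by move=> x x_in; split => //; exact: onL.
have sC : shift (lengths (1, 0)) Llong = 0 by rewrite /=; ring.
have sD : shift (lengths (1, 0)) Lshort = 0 by rewrite /=; ring.
exists [:: Lshort], f, (f + 1), [:: Llong], 0, f; split.
- by apply: tow => //; rewrite /= /width /=; [move=> x|]; lra.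
- by apply: tow => //; rewrite /=; move=> x; lra.
- by rewrite /disp !big_cons !big_nil; congr pair; ring.
- by rewrite /disp !big_cons !big_nil /=; congr pair; ring.
- move=> S invS x /invS [L onL _]; exists [::] => //; rewrite shifts_nil addr0.
  by move: onL; case: L; rewrite /= /width /= => *; [lra|lra|right; lra|left; lra].
Qed.

End Directions.

(** * The double pentagon in golden coordinates *)

Section Golden.
Variable R : realType.
Local Notation f := (phi R).

Lemma phi_sq : f * f = f + 1.
Proof.
have s5 : Num.sqrt 5 * Num.sqrt 5 = 5 :> R by rewrite -expr2 sqr_sqrtr.
by rewrite /phi; field: s5.
Qed.

Lemma phi_bounds : 3 / 2 < f < 2.
Proof.
have s5 : Num.sqrt 5 * Num.sqrt 5 = 5 :> R by rewrite -expr2 sqr_sqrtr.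
have s0 : 0 <= Num.sqrt 5 :> R by exact: sqrtr_ge0.
by rewrite /phi; nra.
Qed.

Lemma phi_gt0 : 0 < f. Proof. by have := phi_bounds; lra. Qed.

Let a : R := 2 * pi / 5.

Lemma sin72_gt0 : 0 < sin (2 * pi / 5 : R).
Proof. by apply: sin_gt0_pi; have := pi_gt0 R; lra. Qed.

Lemma cos72 : cos (2 * pi / 5 : R) = (f - 1) / 2.
Proof.
rewrite -/a; set C := cos a; set S := sin a.
have S_gt0 : 0 < S by exact: sin72_gt0.
have C_gt0 : 0 < C by apply: cos_gt0_pihalf; rewrite /a; have := pi_gt0 R; lra.
have CS : C ^+ 2 + S ^+ 2 = 1 by exact: cos2Dsin2.
have c2 : cos (a + a) = C * C - S * S by exact: cosD.
have s2 : sin (a + a) = S * C + C * S by exact: sinD.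
(* The angles 3 a and 2 a are opposite, which gives a cubic equation for cos a. *)
have c3 : cos (a + a + a) = cos (a + a).
  have -> : a + a + a = - (a + a) + pi *+ 2 by rewrite /a mulr2n; field.
  by rewrite cosD2pi cosN.
rewrite cosD -/C -/S c2 s2 in c3.
have e : (C - 1) * (4 * C * C + 2 * C - 1) = 0.
  have S2 : S * S = 1 - C * C by rewrite -CS; ring.
  have sc : (S * C + C * S) * S = 2 * C * (S * S) by ring.
  by rewrite sc S2 in c3; lra.
move/eqP: e; rewrite mulf_eq0 => /orP[/eqP C1|/eqP e]; first by nra.
have ff := phi_sq; have := phi_bounds => fb.
have : (C - (f - 1) / 2) * (C + f / 2) = 0 by lra.
by move/eqP; rewrite mulf_eq0 => /orP[/eqP ?|/eqP ?]; lra.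
Qed.

Lemma sin36_cot72 : sin (pi / 5) * (cos (2 * pi / 5) / sin (2 * pi / 5)) = 1 - f / 2 :> R.
Proof.
pose b : R := pi / 5.
have eb : 2 * pi / 5 = b + b :> R by rewrite /b; field.
have cb : 0 < cos b by apply: cos_gt0_pihalf; rewrite /b; have := pi_gt0 R; lra.
have S_gt0 := sin72_gt0; have C72 := cos72; have ff := phi_sq; have fb := phi_bounds.
have CS : cos b ^+ 2 + sin b ^+ 2 = 1 by exact: cos2Dsin2.
have c2 : (f - 1) / 2 = cos b * cos b - sin b * sin b by rewrite -C72 eb cosD.
have s2 : sin (2 * pi / 5) = 2 * (sin b * cos b) by rewrite eb sinD; ring.
have cbE : cos b = f / 2.
  have : (cos b - f / 2) * (cos b + f / 2) = 0 by lra.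
  by move/eqP; rewrite mulf_eq0 => /orP[/eqP ?|/eqP ?]; lra.
have s0 : sin b != 0 by apply/eqP => s0; rewrite s0 in s2; lra.
rewrite C72 s2 cbE -/b; have f0 : f != 0 by apply/eqP; lra.
have e : (f - 1) / 2 = (1 - f / 2) * f by lra.
by rewrite e; field; rewrite s0 f0.
Qed.

(** The vector p e + q e': both ends of the sector have the same height and
    opposite abscissas. *)
Definition gvec (v : R * R) : 'rV[R]_2 :=
  \row_(i < 2) (if i == 0 then (v.1 - v.2) * cos (2 * pi / 5)
                else (v.1 + v.2) * sin (2 * pi / 5)).

Definition side_coord (i : 'I_5) : R * R :=
  nth (0, 0) [:: (f, - f); (1, 0); (- 1, f); (- f, 1); (0, - 1)] i.

Definition vertex_coord (i : 'I_5) : R * R :=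
  nth (0, 0) [:: (0, 0); (f, - f); (f + 1, - f); (f, 0); (0, 1)] i.

Lemma gvecD v w : gvec (v + w) = gvec v + gvec w.
Proof. by apply/rowP => i; rewrite !mxE /=; case: ifP => _; ring. Qed.

Lemma gvecZ k v : gvec (k * v.1, k * v.2) = k *: gvec v.
Proof. by apply/rowP => i; rewrite !mxE /=; case: ifP => _; ring. Qed.

Lemma gvecN v : gvec (- v) = - gvec v.
Proof. by apply/rowP => i; rewrite !mxE /=; case: ifP => _; ring. Qed.

Lemma gvec_inj : injective gvec.
Proof.
move=> [x y] [x' y'] /rowP e.
have := e 0; have := e 1; rewrite !mxE /= cos72.
have S0 : sin (2 * pi / 5) != 0 :> R by rewrite gt_eqF // sin72_gt0.
have C0 : (f - 1) / 2 != 0 by have := phi_bounds => ?; apply/eqP; lra.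
by move=> /(mulIf S0) ? /(mulIf C0) ?; congr pair; lra.
Qed.

Lemma side_vectorE i : side_vector R i = gvec (side_coord i).
Proof.
have ff := phi_sq; have C : cos a = (f - 1) / 2 := cos72.
have c2 : cos (a + a) = - f / 2.
  by rewrite cosD; have := cos2Dsin2 a; rewrite C => h; lra.
have s2 : sin (a + a) = (f - 1) * sin a by rewrite sinD C; lra.
have c3 : cos (pi *+ 2 - (a + a)) = - f / 2 by rewrite addrC cosD2pi cosN.
have s3 : sin (pi *+ 2 - (a + a)) = - ((f - 1) * sin a) by rewrite addrC sinD2pi sinN s2.
have c4 : cos (pi *+ 2 - a) = (f - 1) / 2 by rewrite addrC cosD2pi cosN.
have s4 : sin (pi *+ 2 - a) = - sin a by rewrite addrC sinD2pi sinN.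
apply/rowP => k; rewrite !mxE -/a C.
case: i => [[|[|[|[|[|//]]]]] lti] /=.
- have -> : 2 * pi * 0 / 5 = 0 :> R by ring.
  by rewrite cos0 sin0; case: ifP => _; lra.
- have -> : 2 * pi * 1 / 5 = a :> R by rewrite /a; ring.
  by rewrite C; case: ifP => _; lra.
- have -> : 2 * pi * 2 / 5 = a + a :> R by rewrite /a; ring.
  by rewrite c2 s2; case: ifP => _; lra.
- have -> : 2 * pi * 3 / 5 = pi *+ 2 - (a + a) :> R by rewrite /a mulr2n; field.
  by rewrite c3 s3; case: ifP => _; lra.
- have -> : 2 * pi * 4 / 5 = pi *+ 2 - a :> R by rewrite /a mulr2n; field.
  by rewrite c4 s4; case: ifP => _; lra.
Qed.

Lemma vertexE i : vertex R i = gvec (vertex_coord i).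
Proof.
rewrite /vertex big_mkcond /= !big_ord_recl big_ord0 addr0 !side_vectorE /=.
rewrite /bump /= /side_coord /=.
have g0 : gvec (0, 0) = 0 by apply/rowP => k; rewrite !mxE /=; case: ifP => _; ring.
rewrite -!g0 -!(fun_if gvec) -!gvecD; congr gvec.
by case: i => [[|[|[|[|[|//]]]]] lti] /=; congr pair => /=; ring.
Qed.

End Golden.

(** * Chains, closed trajectories and blocks *)

(** The predecessors of a repeated point coincide, so a first repetition can only
    be that of the starting point. *)
Lemma codeterministic_path_uniq (T : eqType) (e : rel T) x p :
  (forall y y' z, e y z -> e y' z -> y = y') -> path e x p -> x \notin p ->
  uniq (x :: p).
Proof.
move=> codet; elim/last_ind: p => [//|p y IH]; rewrite rcons_path mem_rcons inE negb_or.
move=> /andP[xp ey] /andP[xy xNp]; have uq := IH xp xNp.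
rewrite -rcons_cons rcons_uniq uq andbT inE negb_or eq_sym xy /=.
apply/negP => yp.
have [p1 [p2 def_p]] : exists p1 p2, p = p1 ++ y :: p2.
  by case/splitPr: yp => p1 p2; exists p1, p2.
have ey' : e (last x p1) y by move: xp; rewrite def_p cat_path /= => /and3P[].
have := codet _ _ _ ey ey'; rewrite def_p last_cat /= => el.
move: uq; rewrite def_p -cat_cons cat_uniq => /and3P[_ /hasPn h _].
by have := h _ (mem_last y p2); rewrite el mem_last.
Qed.

Section Chains.
Variables (R : realType) (theta : R).
Local Notation next := (next_crossing theta).
Hypothesis det : forall s s1 s2, next s s1 -> next s s2 -> s1 = s2.
Hypothesis codet : forall s s1 s2, next s1 s -> next s2 s -> s1 = s2.
Implicit Types (c : seq (crossing R)) (s : crossing R).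

Lemma closed_succ c s : closed_trajectory theta c -> s \in c ->
  exists2 s', next s s' & s' \in c.
Proof.
case=> _ uq cyc sc; exists (path.next c s); last by rewrite mem_next.
exact/asboolP/(next_cycle cyc sc).
Qed.

Lemma closed_pred c s : closed_trajectory theta c -> s \in c ->
  exists2 s', next s' s & s' \in c.
Proof.
case=> _ uq cyc sc; exists (path.prev c s); last by rewrite mem_prev.
exact/asboolP/(prev_cycle cyc sc).
Qed.

Lemma closed_next c s s' : closed_trajectory theta c -> s \in c -> next s s' ->
  s' \in c.
Proof. by move=> cl sc n; have [s1 n1 s1c] := closed_succ cl sc; rewrite (det n n1). Qed.

Lemma closed_prev c s s' : closed_trajectory theta c -> s' \in c -> next s s' ->
  s \in c.
Proof. by move=> cl sc n; have [s1 n1 s1c] := closed_pred cl sc; rewrite (codet n n1). Qed.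

Lemma closed_path c s p : closed_trajectory theta c ->
  path [rel s s' | `[< next s s' >]] s p -> last s p \in c -> s \in c.
Proof.
move=> cl; elim: p s => [//|s' p IH] s /= /andP[/asboolP n ps] lc.
exact: closed_prev (IH _ ps lc) n.
Qed.

(** Successors are determined, so two closed trajectories with a common crossing
    run through the same crossings. *)
Lemma closed_sub c c' s : closed_trajectory theta c -> closed_trajectory theta c' ->
  s \in c -> s \in c' -> {subset c <= c'}.
Proof.
move=> [_ _ cyc] cl' sc sc'.
have key p : forall s0, path [rel s s' | `[< next s s' >]] s0 p -> s0 \in c' ->
    {subset s0 :: p <= c'}.
  elim: p => [|s' p IH] s0 /=; first by move=> _ ? y; rewrite inE => /eqP->.
  move=> /andP[/asboolP n ps] s0c y; rewrite inE => /orP[/eqP->//|].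
  by apply: IH ps _ _; apply: closed_next n.
have [i p def_c] := rot_to sc.
have : cycle [rel s s' | `[< next s s' >]] (s :: p) by rewrite -def_c rot_cycle.
rewrite /= rcons_path => /andP[ps _] x; rewrite -(mem_rot i) def_c.
exact: key.
Qed.

Lemma closed_size c c' s : closed_trajectory theta c -> closed_trajectory theta c' ->
  s \in c -> s \in c' -> size c = size c'.
Proof.
move=> cl cl' sc sc'; case: (cl) (cl') => _ uq _ [_ uq' _].
apply/eqP; rewrite eqn_leq; apply/andP; split; apply: uniq_leq_size => //.
  exact: closed_sub sc sc'.
exact: closed_sub sc' sc.
Qed.

Lemma same_strip_sym s s' : same_strip theta s s' -> same_strip theta s' s.
Proof.
elim=> [c s1 s2 cl h1 h2|b i t t' h|s1 s2 s3 _ h1 _ h2].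
- exact: same_strip_follow cl h2 h1.
- by apply: same_strip_slide => r rr; apply: h; rewrite orbC.
- exact: same_strip_trans h2 h1.
Qed.

End Chains.

(** The period in terms of the number of Roman letters. *)
Definition period (num : numeration) (n : nat) : nat :=
  if num is Arabic then n.*2 else n.

Lemma size_roman_flatten r : size (flatten [seq roman_block x | x <- r]) = (size r).*2.
Proof. by elim: r => [//|[] r IH] /=; rewrite IH. Qed.

(** A Roman word is read off some rotation of the Arabic one, of which it has
    half the length, wherever the blocks begin. *)
Lemma word_period_size num (w : seq nat) m k : word_period num w m -> size w = k.*2 ->
  m = period num k.
Proof.
case: num => /= [-> //|[r [j e] <-] ek].
by apply: double_inj; rewrite -ek -(size_rot j w) e size_roman_flatten.
Qed.

Lemma leq_period num m n : (m <= n)%N -> (period num m <= period num n)%N.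
Proof. by case: num => //=; rewrite leq_double. Qed.

Lemma periodD num m n : period num (m + n) = (period num m + period num n)%N.
Proof. by case: num => //=; rewrite doubleD. Qed.

Section Segments.
Variable R : realType.
Local Open Scope classical_set_scope.

Lemma segment_separation (a b : R) (V1 V2 : set R) : open V1 -> open V2 ->
  (forall t, a <= t <= b -> V1 t \/ V2 t) ->
  (forall t, a <= t <= b -> V1 t -> V2 t -> False) ->
  forall x y, a <= x <= b -> a <= y <= b -> V1 x -> V1 y.
Proof.
move=> o1 o2 cov dis x y xab yab V1x.
have e : `[a, b]%classic `&` V1 = `[a, b]%classic.
  apply: (@segment_connected R a b).
  - by exists x; split=> //; rewrite /= in_itv.
  - by exists V1.
  - exists (~` V2); first exact: open_closedC.
    apply/seteqP; split=> t [/= tab]; have := tab; rewrite in_itv /= => tab'.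
      by move=> V1t; split=> //= V2t; exact: dis V1t V2t.
    by move=> nV2; split=> //=; case: (cov t tab').
have : `[a, b]%classic y by rewrite /= in_itv.
by rewrite -e => -[].
Qed.

End Segments.

(** * Crossings and the transversal coordinate *)

Section Crossings.
Variable R : realType.
Local Notation f := (phi R).
Implicit Types (b : bool) (i : 'I_5) (t : R) (v : R * R).

Definition point b i t : R * R :=
  let x := vertex_coord R i in let s := side_coord R i in
  if b then (- (x.1 + (1 - t) * s.1), - (x.2 + (1 - t) * s.2))
  else (x.1 + t * s.1, x.2 + t * s.2).

Lemma side_pointE b i t : side_point b i t = gvec (point b i t).
Proof.
rewrite /side_point /point vertexE side_vectorE.
by case: b; rewrite -gvecZ -gvecD -?gvecN.
Qed.

(** Upward trajectories enter P' through its sides 2 and 3, and P through its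
    sides 0, 1 and 4. *)
Definition enters b i : bool := b == (1 < i < 4)%N.

(** The signed area spanned by v and the point is constant along a chord; the
    added constant makes the chords of either copy fill an interval that starts
    at 0. *)
Definition pos v b i t : R :=
  v.2 * (point b i t).1 - v.1 * (point b i t).2 +
  (if b then (f + 1) * v.2 + f * v.1 else v.1).

(** It increases in every direction of the sector and separates the sides through
    which trajectories enter from those through which they leave. *)
Definition height b i t : R := (point b i t).1 + (point b i t).2.

Lemma height_side b i t : 0 < t < 1 ->
  let c : R := if b then - 1 else 1 in
  if enters b i then height b i t < c else c < height b i t.
Proof.
have fb := phi_bounds R => t01 /=.
have ft : 0 < (f - 1) * t by apply: mulr_gt0; lra.
have ft' : 0 < (f - 1) * (1 - t) by apply: mulr_gt0; lra.
rewrite /height /point /enters /vertex_coord /side_coord.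
by case: b; case: i => [[|[|[|[|[|//]]]]] lti] /=; lra.
Qed.

Section Direction.
Variables (theta : R) (v : R * R).
Local Notation next := (next_crossing theta).
Local Notation len := (lengths f v).
Local Notation W := (width len).

(** In P' the interval of positions is divided between the sides 2, 3 below and
    between the sides 1, 0, 4 above; in P the sides come in the opposite order.
    The exchange of four intervals is the composition of these two reversals. *)
Lemma posE b i t : pos v b i t =
  let L := lengths f v in
  nth 0 (if b then
    [:: L Rshort + (L Rlong + L Llong) * t; L Rshort * t;
        (L Llong + L Rshort) * (1 - t);
        L Llong + L Rshort + (L Lshort + L Rlong) * (1 - t);
        L Rshort + L Rlong + L Llong + L Lshort * t]
  else
    [:: L Lshort + (L Rlong + L Llong) * t;
        L Lshort + L Rlong + L Llong + L Rshort * t;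
        L Lshort + L Rlong + (L Llong + L Rshort) * (1 - t);
        (L Lshort + L Rlong) * (1 - t); L Lshort * t]) i.
Proof.
rewrite /pos /point /vertex_coord /side_coord.
by case: b; case: i => [[|[|[|[|[|//]]]]] lti] /=; ring.
Qed.

Definition directed : Prop :=
  [/\ 0 <= v.1, 0 <= v.2, 0 < v.1 + v.2 &
      exists2 l, 0 < l & unit_vector theta = l *: gvec v].

Hypothesis dir : directed.

Lemma len_facts : [/\ 0 <= v.1, 0 <= v.2, 0 < v.1 + v.2, v.1 <= f * v.1 & v.2 <= f * v.2].
Proof.
case: dir => v1 v2 v12 _; have fb := phi_bounds R.
by split=> //; rewrite ler_peMl //; lra.
Qed.

(** With these products treated as atoms, the facts on positions below are linear. *)
Lemma len_monomials t : 0 < t < 1 ->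
  [/\ 0 <= v.1 * t <= v.1, 0 <= v.2 * t <= v.2,
      0 < (f * v.1 + f * v.2) * t < f * v.1 + f * v.2,
      0 < (f * v.1 + v.2) * t < f * v.1 + v.2 &
      0 < (v.1 + f * v.2) * t < v.1 + f * v.2].
Proof.
move=> /andP[t0 t1]; have [v1 v2 v12 fv1 fv2] := len_facts.
have le_s (s : R) : 0 <= s -> 0 <= s * t <= s.
  by move=> s0; rewrite mulr_ge0 ?(ltW t0) //= ler_piMr // ltW.
have lt_s (s : R) : 0 < s -> 0 < s * t < s.
  by move=> s0; rewrite mulr_gt0 //= gtr_pMr.
have q3 : 0 < f * v.1 + f * v.2 by lra.
have q4 : 0 < f * v.1 + v.2 by lra.
have q5 : 0 < v.1 + f * v.2 by lra.
by split; first [exact: le_s | exact: lt_s].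
Qed.

Lemma pos_sides_disjoint b i i' t t' : 0 < t < 1 -> 0 < t' < 1 ->
  enters b i = enters b i' -> pos v b i t = pos v b i' t' -> i = i'.
Proof.
have [v1 v2 v12 fv1 fv2] := len_facts.
move=> /len_monomials[m1 m2 m5 m6 m7] /len_monomials[n1 n2 n5 n6 n7].
rewrite !posE /enters => ee e; apply/val_inj; move: ee e.
case: b; case: i => [[|[|[|[|[|//]]]]] lti]; case: i' => [[|[|[|[|[|//]]]]] lti'] //= _ e;
 by exfalso; lra.
Qed.

(** Chords are recognized by their constant position; [height] tells their lower
    end from their upper end. *)
Lemma chord_iff b i t i' t' : 0 < t < 1 -> 0 < t' < 1 ->
  (i != i' /\ exists2 k, 0 < k &
     point b i' t' - point b i t = (k * v.1, k * v.2)) <->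
  [/\ enters b i, enters (~~ b) i' & pos v b i t = pos v b i' t'].
Proof.
move=> t01 t01'; have [v1 v2 v12 fv1 fv2] := len_facts.
have enN : enters (~~ b) i' = ~~ enters b i' by rewrite /enters; case: b; case: (_ && _).
rewrite enN.
have h1 := height_side b i t01; have h2 := height_side b i' t01'.
have same := @pos_sides_disjoint b i i' t t' t01 t01'.
move: h1 h2; rewrite /height /pos in same *.
set P := point b i t in same *; set P' := point b i' t' in same *.
move=> h1 h2; split=> [[ii' [k k0 [ex ey]]]|[en en' e]].
  have e : v.2 * P.1 - v.1 * P.2 = v.2 * P'.1 - v.1 * P'.2.
    have -> : P'.1 = P.1 + k * v.1 by rewrite -ex; ring.
    have -> : P'.2 = P.2 + k * v.2 by rewrite -ey; ring.
    by ring.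
  have kv : 0 < k * (v.1 + v.2) by apply: mulr_gt0.
  rewrite e in same *.
  case en : (enters b i) h1 same; case en' : (enters b i') h2 => //= h2 h1 same.
  - by move: ii'; rewrite same ?eqxx.
  - by exfalso; lra.
  - by move: ii'; rewrite same ?eqxx.
split; first by apply: contraTneq en' => <-; rewrite en.
rewrite en (negbTE en') in h1 h2.
exists ((P'.1 + P'.2 - (P.1 + P.2)) / (v.1 + v.2)); first by apply: divr_gt0 => //; lra.
have v0 : v.1 + v.2 != 0 by rewrite gt_eqF.
have e' : v.2 * (P'.1 - P.1) = v.1 * (P'.2 - P.2) by move: e; case: (b); lra.
congr pair => /=.
  apply: (mulIf v0); rewrite [RHS](_ : _ = (P'.1 + P'.2 - (P.1 + P.2)) * v.1); last by field.
  by lra.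
apply: (mulIf v0); rewrite [RHS](_ : _ = (P'.1 + P'.2 - (P.1 + P.2)) * v.2); last by field.
by lra.
Qed.

Lemma next_crossingE b i t b' i' t' :
  next (b, i, t) (b', i', t') <->
  [/\ 0 < t < 1, 0 < t' < 1, b' = ~~ b,
      enters b i && enters (~~ b) i' & pos v b i t = pos v b i' t'].
Proof.
have [_ _ _ [l l_gt0 dirE]] := dir.
have key k : side_point b i' t' - side_point b i t = k *: unit_vector theta <->
    point b i' t' - point b i t = (k * l * v.1, k * l * v.2).
  rewrite !side_pointE dirE scalerA -gvecZ -gvecN -gvecD; split=> [/gvec_inj //|e].
  by congr gvec.
split=> [[t01 t01' eb ii' [k k0 /key e]]|[t01 t01' eb /andP[en en'] e]].
  have [|en en' ep] := (chord_iff b i i' t01 t01').1.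
    by split=> //; exists (k * l) => //; exact: mulr_gt0.
  by rewrite en en'.
have [ii' [k k0 ek]] := (chord_iff b i i' t01 t01').2 (And3 en en' e).
split=> //; exists (k / l); first exact: divr_gt0.
by apply/key; rewrite divfK ?gt_eqF.
Qed.

(** This also excludes the sides parallel to v, whose points all have the
    position of an end of the interval. *)
Lemma pos_range b i t i' t' : 0 < t < 1 -> 0 < t' < 1 ->
  enters b i -> enters (~~ b) i' -> pos v b i t = pos v b i' t' ->
  0 < pos v b i t < width (lengths f v).
Proof.
have [v1 v2 v12 fv1 fv2] := len_facts.
move=> /len_monomials[m1 m2 m5 m6 m7] /len_monomials[n1 n2 n5 n6 n7].
rewrite !posE /enters /width.
case: b; case: i => [[|[|[|[|[|//]]]]] lti] //=; case: i' => [[|[|[|[|[|//]]]]] lti'] //= _ _ e;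
 lra.
Qed.

Lemma pos_inj b i i' t t' : 0 < t < 1 -> 0 < t' < 1 -> enters b i = enters b i' ->
  0 < pos v b i t < width (lengths f v) -> pos v b i t = pos v b i' t' ->
  (i, t) = (i', t').
Proof.
have [v1 v2 v12 fv1 fv2] := len_facts.
move=> t01 t01' ee rg e; have ii' := pos_sides_disjoint t01 t01' ee e.
move: e {ee}; rewrite -{}ii' => e; congr pair; apply/eqP; rewrite -subr_eq0.
have [m1 m2 m5 m6 m7] := len_monomials t01.
have nz (s : R) : s * (t - t') = 0 -> s != 0 -> t - t' == 0.
  by move=> e0 s0; move/eqP: e0; rewrite mulf_eq0 (negbTE s0).
move: e rg; rewrite !posE /width.
case: b; case: i => [[|[|[|[|[|//]]]]] lti] //= e rg.
- by apply: (nz (f * v.2 + f * v.1)); [lra | apply/eqP; lra].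
- by apply: (nz v.2); [lra | apply/eqP => z; rewrite z in rg; lra].
- by apply: (nz (f * v.1 + v.2)); [lra | apply/eqP; lra].
- by apply: (nz (v.1 + f * v.2)); [lra | apply/eqP; lra].
- by apply: (nz v.1); [lra | apply/eqP => z; rewrite z in rg; lra].
- by apply: (nz (f * v.2 + f * v.1)); [lra | apply/eqP; lra].
- by apply: (nz v.2); [lra | apply/eqP => z; rewrite z in rg; lra].
- by apply: (nz (f * v.1 + v.2)); [lra | apply/eqP; lra].
- by apply: (nz (v.1 + f * v.2)); [lra | apply/eqP; lra].
- by apply: (nz v.1); [lra | apply/eqP => z; rewrite z in rg; lra].
Qed.

Lemma next_det s s1 s2 :
  next s s1 -> next s s2 -> s1 = s2.
Proof.
case: s s1 s2 => [[b i] t] [[b1 i1] t1] [[b2 i2] t2].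
move=> /next_crossingE[t01 t11 -> /andP[en en1] e1] /next_crossingE[_ t21 -> /andP[_ en2] e2].
have rg := pos_range t01 t11 en en1 e1.
have ee : enters b i1 = enters b i2.
  by move: en1 en2; rewrite /enters; case: b {e1 e2 en rg}; case: (_ && _); case: (_ && _).
rewrite e1 in rg e2.
by have [-> ->] := pos_inj t11 t21 ee rg e2.
Qed.

Lemma next_codet s s1 s2 :
  next s1 s -> next s2 s -> s1 = s2.
Proof.
case: s s1 s2 => [[b i] t] [[b1 i1] t1] [[b2 i2] t2].
move=> /next_crossingE[t11 t01 eb /andP[en1 en] e1] /next_crossingE[t21 _ eb' /andP[en2 _] e2].
have bb : b2 = b1 by move: eb'; rewrite eb => /negb_inj.
rewrite {}bb in en2 e2 *.
have rg := pos_range t11 t01 en1 en e1.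
rewrite -e2 in e1.
have ee : enters b1 i1 = enters b1 i2 by rewrite en1 en2.
by have [-> ->] := pos_inj t11 t21 ee rg e1.
Qed.

(** * Coding trajectories by the interval exchange *)

(** The position of the lowest vertex of P', between its sides 2 and 3. *)
Definition bottom : R := f * v.1 + v.2.

(** The crossings at position x: [lower x] into P' and [upper x] out of it. *)
Definition lower (x : R) : crossing R :=
  if x < bottom then (true, @Ordinal 5 2 isT, 1 - x / bottom)
  else (true, @Ordinal 5 3 isT, 1 - (x - bottom) / (v.1 + f * v.2)).

Definition upper (x : R) : crossing R :=
  if x < v.2 then (false, @Ordinal 5 1 isT, x / v.2)
  else if x < W - v.1 then (false, @Ordinal 5 0 isT, (x - v.2) / (f * v.1 + f * v.2))
  else (false, @Ordinal 5 4 isT, (x - (W - v.1)) / v.1).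

Definition coord (s : crossing R) : R := pos v true s.1.2 s.2.

Lemma bottom_bounds : 0 < bottom < W.
Proof. by have [? ? ? ? ?] := len_facts; rewrite /bottom /width /=; lra. Qed.

(** Seen from P, the sides 2 and 3 come in the opposite order, hence the rotation
    of the positions. *)
Lemma lower_spec x : 0 < x < W -> x != bottom ->
  let s := lower x in
  [/\ s.1.1 = true, enters true s.1.2, 0 < s.2 < 1, coord s = x &
      pos v false s.1.2 s.2 =
      if x < bottom then v.1 + f * v.2 + x else x - bottom].
Proof.
have [? ? ? ? ?] := len_facts; have := bottom_bounds => cW xW xc.
rewrite /lower /coord; have [xlt|xge] := ltP x bottom.
  split=> //=; last 2 first.
  - by rewrite posE /= /bottom; field; apply/eqP; lra.
  - by rewrite posE /= /bottom; field; apply/eqP; lra.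
  suff : 0 < x / bottom < 1 by lra.
  by rewrite divr_gt0 ?ltr_pdivrMr ?mul1r //; lra.
have {}xge : bottom < x by rewrite lt_neqAle eq_sym xc.
have d0 : 0 < v.1 + f * v.2 by lra.
split=> //=; last 2 first.
- by rewrite posE /= /bottom; field; apply/eqP; lra.
- by rewrite posE /= /bottom; field; apply/eqP; lra.
suff : 0 < (x - bottom) / (v.1 + f * v.2) < 1 by lra.
rewrite divr_gt0 ?ltr_pdivrMr ?mul1r //; last by lra.
by move: xW; rewrite /width /= /bottom; lra.
Qed.

Lemma coord_lower x : 0 < x < W -> x != bottom -> coord (lower x) = x.
Proof. by move=> xW xc; have [] := lower_spec xW xc. Qed.

Lemma upper_spec L x : on_piece len L x ->
  let s := upper x in
  [/\ s.1.1 = false, enters false s.1.2, 0 < s.2 < 1, coord s = x &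
      pos v false s.1.2 s.2 =
      let y := x + shift len L in
      if y < bottom then v.1 + f * v.2 + y else y - bottom].
Proof.
have [? ? ? ? ?] := len_facts; rewrite /upper /coord.
case: L => /= onL.
- have -> : x < v.2 by lra.
  have -> : x + f * v.1 < bottom by rewrite /bottom; lra.
  split => //=.
  + by rewrite divr_gt0 ?ltr_pdivrMr ?mul1r //; lra.
  + by rewrite posE /=; field; apply/eqP; lra.
  + by rewrite posE /=; field; apply/eqP; lra.
- have -> : (x < v.2) = false by apply/negbTE; lra.
  have -> : x < W - v.1 by rewrite /width /=; lra.
  have -> : (x + (f * v.1 + v.1) < bottom) = false by apply/negbTE; rewrite /bottom; lra.
  split => //=.
  + by rewrite divr_gt0 ?ltr_pdivrMr ?mul1r //; lra.
  + by rewrite posE /=; field; apply/eqP; lra.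
  + by rewrite posE /= /bottom; field; apply/eqP; lra.
- have -> : (x < v.2) = false by apply/negbTE; lra.
  have -> : x < W - v.1 by rewrite /width /=; lra.
  have -> : x - (v.2 + f * v.2) < bottom by rewrite /bottom; lra.
  split => //=.
  + by rewrite divr_gt0 ?ltr_pdivrMr ?mul1r //; lra.
  + by rewrite posE /=; field; apply/eqP; lra.
  + by rewrite posE /= /bottom; field; apply/eqP; lra.
- move: onL; rewrite /width /= => onL.
  have -> : (x < v.2) = false by apply/negbTE; lra.
  have -> : (x < v.2 + f * v.2 + f * v.1 + v.1 - v.1) = false by apply/negbTE; lra.
  have -> : (x - f * v.2 < bottom) = false by apply/negbTE; rewrite /bottom; lra.
  split => //=.
  + by rewrite divr_gt0 ?ltr_pdivrMr ?mul1r //; lra.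
  + by rewrite posE /=; field; apply/eqP; lra.
  + by rewrite posE /= /bottom; field; apply/eqP; lra.
Qed.

(** The position of the lowest vertex separates the images of Rshort and
    Lshort. *)
Lemma shift_neq_bottom L x : on_piece len L x -> x + shift len L != bottom.
Proof.
have [? ? ? ? ?] := len_facts; rewrite /bottom.
by case: L; rewrite /= /width /= => ?; apply/eqP; lra.
Qed.

Lemma len_ge0 : nonneg len.
Proof. by have [? ? ? ? ?] := len_facts; case=> /=; lra. Qed.

Lemma next_lower_upper L x : on_piece len L x -> x != bottom -> next (lower x) (upper x).
Proof.
move=> onL xc; have xW := on_piece_range len_ge0 onL.
have [] := lower_spec xW xc; have [] := upper_spec onL; rewrite /coord.
case: (upper x) => [[b i] t]; case: (lower x) => [[b' i'] t'] /= -> en t01 e _ -> en' t01' e' _.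
by apply/next_crossingE; split; rewrite ?en ?en' // e.
Qed.

Lemma next_upper_lower L x : on_piece len L x -> next (upper x) (lower (x + shift len L)).
Proof.
move=> onL; have yW := shift_range len_ge0 onL.
have [] := lower_spec yW (shift_neq_bottom onL); have [] := upper_spec onL; rewrite /coord.
case: (upper x) => [[b i] t]; case: (lower _) => [[b' i'] t'] /= -> en t01 _ e -> en' t01' _ e'.
by apply/next_crossingE; split; rewrite ?en ?en' // e.
Qed.

Lemma lower_coord s s' : s.1.1 = true -> next s s' ->
  [/\ 0 < coord s < W, coord s != bottom & s = lower (coord s)].
Proof.
case: s s' => [[b i] t] [[b' i'] t'] /= -> /next_crossingE[t01 t01' _ /andP[en en'] e].
have [v1 v2 v12 ? ?] := len_facts.
have rg : 0 < coord (true, i, t) < W := pos_range t01 t01' en en' e.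
have nc : coord (true, i, t) != bottom.
  rewrite /coord /= posE /bottom; move: en; rewrite /enters.
  have [_ _ ? ? ?] := len_monomials t01.
  by case: i {e rg} => [[|[|[|[|[|//]]]]] lti] //= _; apply/eqP; lra.
split=> //; have := lower_spec rg nc; rewrite [in X in _ -> X]/coord /=.
case: (lower _) => [[b1 i1] t1] /= [-> en1 t11 + _]; rewrite /coord /= => e1.
have ee : enters true i1 = enters true i by rewrite en1 en.
rewrite /coord /= -e1 in rg.
by have [-> ->] := pos_inj t11 t01 ee rg e1.
Qed.

(** Six pairs of sides can be crossed after [lower x], and each of these pairs
    occurs on one piece only. *)
Lemma next_lower x s1 s2 : 0 < x < W -> x != bottom -> next (lower x) s1 -> next s1 s2 ->
  exists2 L, on_piece len L x & s2 = lower (x + shift len L).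
Proof.
move=> xW xc n1 n2.
suff [L onL] : exists L, on_piece len L x.
  exists L => //; have e1 := next_det n1 (next_lower_upper onL xc).
  by rewrite e1 in n2; exact: next_det n2 (next_upper_lower onL).
have [v1 v2 v12 ? ?] := len_facts.
have [+ _ _ + _] := lower_spec xW xc; move: n1; rewrite /coord.
case: (lower x) => [[b i] t] /=; case: s1 n2 => [[b1 i1] t1] n2 n1 eb ex.
case: s2 n2 => [[b2 i2] t2] n2.
rewrite {}eb in n1; move/next_crossingE: n1 => [_ t11 eb1 /andP[_ en1]]; rewrite ex => {}ex.
rewrite {}eb1 in n2; move/next_crossingE: n2 => [_ t21 _ /andP[_ en2]] ey.
move: ex ey en1 en2; rewrite !posE /enters.
have [m1 m2 m5 m6 m7] := len_monomials t11.
have [_ _ m5' m6' m7'] := len_monomials t21.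
move: xW; rewrite /width /= => xW.
case: i1 => [[|[|[|[|[|//]]]]] lti] //= ex;
  case: i2 => [[|[|[|[|[|//]]]]] lti'] //= ey _ _.
- by exists Llong => /=; lra.
- by exists Rlong => /=; lra.
- by exists Rshort => /=; lra.
- by exists Rshort => /=; lra.
- by exists Lshort => /=; rewrite /width /=; lra.
- by exists Lshort => /=; rewrite /width /=; lra.
Qed.

(** * Strips are towers *)

Local Open Scope classical_set_scope.
Local Notation step := [rel s s' | `[< next s s' >]].

Fixpoint orbit_from w x : seq (crossing R) :=
  if w is L :: w' then lower x :: upper x :: orbit_from w' (x + shift len L) else [::].

Fixpoint orbit_after w x : seq (crossing R) :=
  if w is L :: w' then
    upper x :: lower (x + shift len L) :: orbit_after w' (x + shift len L)
  else [::].

Lemma orbit_afterE w x :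
  lower x :: orbit_after w x = rcons (orbit_from w x) (lower (x + shifts len w)).
Proof.
elim: w x => [|L w IH] x /=; first by rewrite shifts_nil addr0.
by rewrite IH shifts_cons addrA.
Qed.

Lemma last_orbit_after w x : last (lower x) (orbit_after w x) = lower (x + shifts len w).
Proof. by have := congr1 (last (lower x)) (orbit_afterE w x); rewrite last_rcons. Qed.

Lemma path_orbit_after w x : follows len w x -> x != bottom ->
  path step (lower x) (orbit_after w x).
Proof.
elim: w x => [//|L w IH] x /= [onL fw] xc.
apply/and3P; split; [apply/asboolP|apply/asboolP|].
- exact: next_lower_upper onL xc.
- exact: next_upper_lower onL.
- exact: IH fw (shift_neq_bottom onL).
Qed.

Lemma follows_neq_bottom w x : follows len w x -> x != bottom ->
  x + shifts len w != bottom.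
Proof.
elim: w x => [|L w IH] x /=; first by rewrite shifts_nil addr0.
by move=> [onL fw] _; rewrite shifts_cons addrA; apply: IH (shift_neq_bottom onL).
Qed.

Lemma size_orbit_from w x : size (orbit_from w x) = (size w).*2.
Proof. by elim: w x => [//|L w IH] x /=; rewrite IH. Qed.

Lemma mem_orbit_from w x s : s \in orbit_from w x <->
  exists u L u', w = u ++ L :: u' /\
    (s = lower (x + shifts len u) \/ s = upper (x + shifts len u)).
Proof.
elim: w x => [|L w IH] x /=.
  by split=> // -[[|? ?] [? [? []]]].
rewrite !inE; split=> [/or3P[/eqP->|/eqP->|]|].
- by exists [::], L, w; rewrite shifts_nil addr0; split=> //; left.
- by exists [::], L, w; rewrite shifts_nil addr0; split=> //; right.
- case/IH => u [L' [u' [-> h]]]; exists (L :: u), L', u'; split=> //.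
  by rewrite shifts_cons addrA.
case=> -[|L0 u] [L' [u' []]] /= [eL ew] h.
  by move: h; rewrite shifts_nil addr0 => -[->|->]; rewrite eqxx ?orbT.
apply/or3P/Or33/IH; exists u, L', u'; split=> //.
by move: h; rewrite -eL shifts_cons addrA.
Qed.

Section Tower.
Variables (w : seq piece) (l r : R).
Hypothesis tow : tower len w l r.

Lemma tower_point x : l < x < r -> 0 < x < W /\ x != bottom.
Proof.
case: tow => w0 _ sw _ fol x_in; split.
  by case: w w0 (fol x x_in) => [//|L u _] [/(on_piece_range len_ge0)].
case/lastP: w w0 sw (fol x x_in) => [//|u L _].
rewrite -cats1 shifts_cat follows_cat shifts_cons shifts_nil addr0 => e [_ [onL _]].
have := shift_neq_bottom onL.
by have -> : x + shifts len u + shift len L = x by rewrite -addrA e addr0.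
Qed.

Lemma upper_false L x : on_piece len L x -> (upper x).1.1 = false.
Proof. by move=> onL; have [] := upper_spec onL. Qed.

Lemma lower_true x : (lower x).1.1 = true.
Proof. by rewrite /lower; case: ifP. Qed.

Lemma follows_at w' x u L u' : follows len w' x -> w' = u ++ L :: u' ->
  on_piece len L (x + shifts len u).
Proof. by move=> fw ew; move: fw; rewrite ew => /follows_cat[_ []]. Qed.

(** The word brings x back to x, so the crossings form a cycle. By determinism
    backwards, a repetition could only be one of the starting crossing, and x
    does not come back before the end of w. *)
Lemma tower_closed x : l < x < r -> closed_trajectory theta (orbit_from w x).
Proof.
move=> x_in; have [xW xc] := tower_point x_in.
case: (tow) => w0 _ sw prim fol; have fw := fol x x_in.
have px := path_orbit_after fw xc; have ex := orbit_afterE w x.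
rewrite sw addr0 in ex.
have [L [w' ew]] : exists L w', w = L :: w' by case: (w) w0 => // L w'; exists L, w'.
have op : orbit_from w x = lower x :: (upper x :: orbit_from w' (x + shift len L)) by rewrite ew.
set p := upper x :: _ in op; rewrite op in ex *.
have {}ex : orbit_after w x = rcons p (lower x) by case: ex.
rewrite ex in px.
have px' : path step (lower x) p by move: px; rewrite rcons_path => /andP[].
split; [by [] | | exact: px].
apply: (codeterministic_path_uniq _ px').
  by move=> s s' s'' /asboolP n1 /asboolP n2; exact (next_codet n1 n2).
have onL : on_piece len L x by move: fw; rewrite ew => -[].
rewrite inE negb_or; apply/andP; split.
  by apply/eqP => e; have := lower_true x; rewrite e (upper_false onL).
apply/negP => /mem_orbit_from[u [L' [u' [ew' h]]]].
have fu : follows len (L :: u) x /\ on_piece len L' (x + shifts len (L :: u)).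
  by move: fw; rewrite ew ew' -cat_cons follows_cat => -[? []].
have {h} : lower x = lower (x + shifts len (L :: u)).
  rewrite shifts_cons addrA; case: h => // e; have := lower_true x.
  by rewrite e (@upper_false L') // -addrA -shifts_cons; case: fu.
have yW := on_piece_range len_ge0 fu.2.
have yc : x + shifts len (L :: u) != bottom.
  by case: fu => fu _; exact: follows_neq_bottom fu xc.
move=> /(congr1 coord); rewrite !coord_lower // => e.
have := prim (L :: u) (L' :: u'); rewrite ew ew' => /(_ erefl) h; apply: h => //.
by apply: (addrI x); rewrite addr0 -e.
Qed.

Definition in_tower s : Prop := exists2 x, l < x < r & s \in orbit_from w x.

(** The positions at which the trajectories of a tower cross the lower sides of
    P', and also those at which they cross its upper sides. *)
Definition tower_shadow (y : R) : Prop :=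
  exists u L u', w = u ++ L :: u' /\ l < y - shifts len u < r.

Lemma in_tower_shadow s : in_tower s -> tower_shadow (coord s).
Proof.
case=> x x_in /mem_orbit_from[u [L [u' [ew h]]]]; exists u, L, u'; split=> //.
case: (tow) => _ _ _ _ /(_ x x_in) fw.
have onL := follows_at fw ew.
suff -> : coord s = x + shifts len u by rewrite addrK.
case: h => ->; last by have [] := upper_spec onL.
apply: coord_lower => //; first exact: on_piece_range len_ge0 onL.
have [xW xc] := tower_point x_in.
by apply: follows_neq_bottom xc; move: fw; rewrite ew => /follows_cat[].
Qed.

Lemma shadow_in_tower y : tower_shadow y -> in_tower (lower y).
Proof.
case=> u [L [u' [ew y_in]]]; exists (y - shifts len u) => //.
by apply/mem_orbit_from; exists u, L, u'; split=> //; left; rewrite subrK.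
Qed.

Lemma in_tower_closed s : in_tower s -> exists c,
  [/\ closed_trajectory theta c, s \in c & size c = (size w).*2].
Proof.
case=> x x_in sx; exists (orbit_from w x); split=> //; first exact: tower_closed.
exact: size_orbit_from.
Qed.

Lemma closed_in_tower c s s' : closed_trajectory theta c -> s \in c -> s' \in c ->
  in_tower s -> in_tower s'.
Proof.
move=> cl sc s'c [x x_in sx]; exists x => //.
exact: (closed_sub next_det cl (tower_closed x_in) sc sx).
Qed.

(** No point of ]l, r[ is the position of the lowest vertex, so the whole interval
    lies over one side, along which one can slide. *)
Lemma tower_same_strip s s' : in_tower s -> in_tower s' -> same_strip theta s s'.
Proof.
have to_lower s0 x : l < x < r -> s0 \in orbit_from w x -> same_strip theta s0 (lower x).
  move=> x_in s0x; apply: same_strip_follow (tower_closed x_in) s0x _.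
  by case: tow => + _ _ _ _; case: (w) => //= *; rewrite mem_head.
move=> [x x_in sx] [y y_in sy].
apply: same_strip_trans (to_lower _ _ x_in sx) _.
apply: same_strip_trans (same_strip_sym (to_lower _ _ y_in sy)).
have closed_lower z : l < z < r -> on_closed_trajectory theta (lower z).
  move=> z_in; exists (orbit_from w z); first exact: tower_closed.
  by case: tow => + _ _ _ _; case: (w) => //= *; rewrite mem_head.
have nb z : l < z < r -> z != bottom by case/tower_point.
have [? ? ? ? ?] := len_facts.
have c0 : 0 < bottom by have := bottom_bounds; lra.
have d0 : 0 < v.1 + f * v.2 by lra.
have [r_le|lt_r] := leP r bottom.
  have lowerE z : l < z < r -> lower z = (true, @Ordinal 5 2 isT, 1 - z / bottom).
    by move=> z_in; rewrite /lower ifT //; lra.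
  rewrite !lowerE //; apply: same_strip_slide => t t_in.
  have z_in : l < (1 - t) * bottom < r.
    suff : (x <= (1 - t) * bottom <= y) || (y <= (1 - t) * bottom <= x) by lra.
    move: t_in; rewrite -(ler_pM2r c0) -(ler_pM2r c0 t) -(ler_pM2r c0 _ t) -(ler_pM2r c0 t).
    rewrite !mulrBl !mul1r !divfK ?gt_eqF //; lra.
  have := closed_lower _ z_in; rewrite lowerE //.
  by have -> : 1 - (1 - t) * bottom / bottom = t by field; apply/eqP; lra.
have lt_l : bottom <= l.
  by rewrite leNgt; apply/negP => lt_l; have := nb bottom; rewrite eqxx lt_l lt_r => /(_ isT).
have lowerE z : l < z < r -> lower z = (true, @Ordinal 5 3 isT, 1 - (z - bottom) / (v.1 + f * v.2)).
  by move=> z_in; rewrite /lower ifF //; apply/negbTE; lra.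
rewrite !lowerE //; apply: same_strip_slide => t t_in.
have z_in : l < bottom + (1 - t) * (v.1 + f * v.2) < r.
  suff : (x <= bottom + (1 - t) * (v.1 + f * v.2) <= y) ||
         (y <= bottom + (1 - t) * (v.1 + f * v.2) <= x) by lra.
  move: t_in; rewrite -(ler_pM2r d0) -(ler_pM2r d0 t) -(ler_pM2r d0 _ t) -(ler_pM2r d0 t).
  rewrite !mulrBl !mul1r !divfK ?gt_eqF //; lra.
have := closed_lower _ z_in; rewrite lowerE //.
have -> // : 1 - (bottom + (1 - t) * (v.1 + f * v.2) - bottom) / (v.1 + f * v.2) = t.
by field; apply/eqP; lra.
Qed.

Lemma tower_shadow_open i : open [set t | tower_shadow (pos v true i t)].
Proof.
pose k := pos v true i 1 - pos v true i 0; pose m := pos v true i 0.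
have posA t : pos v true i t = k * t + m by rewrite /k /m /pos /point /=; ring.
have -> : [set t | tower_shadow (pos v true i t)] =
    \bigcup_(u in [set u | exists L u', w = u ++ L :: u'])
      ((fun t => k * t + (m - shifts len u)) @^-1` `]l, r[%classic).
  apply/seteqP; split=> t /=.
    move=> [u [L [u' [ew h]]]]; exists u; first by exists L, u'.
    by rewrite /= in_itv /=; rewrite posA in h; lra.
  move=> [u [L [u' ew]]] /=; rewrite in_itv /= => h; exists u, L, u'; split=> //.
  by rewrite posA; lra.
apply: bigcup_open => u _; apply: open_comp; last exact: itv_open.
move=> t _; apply: continuousD; last exact: cst_continuous.
apply: continuousM; first exact: cst_continuous.
exact: cvg_id.
Qed.

End Tower.

(** The four pieces are not the four letters, but the sides crossed at position x
    always have the labels of one letter. *)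
Lemma roman_blocks w x : follows len w x ->
  exists2 r, symbolic_orbit (orbit_from w x) = flatten [seq roman_block y | y <- r] &
             size r = size w.
Proof.
elim: w x => [|L w IH] x /=; first by exists [::].
move=> [_ fw].
have [? ? ? ? ?] := len_facts.
have [y ey] : exists y, [:: label (lower x).1.2; label (upper x).1.2] = roman_block y.
  rewrite /lower /upper; case: (ltP x bottom); case: (ltP x v.2);
    case: (ltP x (W - v.1)); rewrite /bottom /width /= => *.
  - by exists RIII.
  - by exists RIII.
  - by exists RIV.
  - by exfalso; lra.
  - by exfalso; lra.
  - by exfalso; lra.
  - by exists RI.
  - by exists RII.
have [r e <-] := IH _ fw.
by exists (y :: r) => //=; rewrite -ey /= -e.
Qed.

Lemma orbit_word_period num w x : follows len w x ->
  word_period num (symbolic_orbit (orbit_from w x)) (period num (size w)).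
Proof.
case: num => /= fw; first by rewrite size_map size_orbit_from.
by have [r e sz] := roman_blocks fw; exists r => //; exists 0%N; rewrite rot0.
Qed.

Section TwoTowers.
Variables (w1 w2 : seq piece) (l1 r1 l2 r2 : R).
Hypothesis tow1 : tower len w1 l1 r1.
Hypothesis tow2 : tower len w2 l2 r2.
Hypothesis size12 : size w1 <> size w2.
Local Notation in1 := (in_tower w1 l1 r1).
Local Notation in2 := (in_tower w2 l2 r2).
Hypothesis closed_cover : forall s, on_closed_trajectory theta s -> in1 s \/ in2 s.

(** Closed trajectories with a common crossing have the same length. *)
Lemma shadows_disjoint y :
  tower_shadow w1 l1 r1 y -> tower_shadow w2 l2 r2 y -> False.
Proof.
move=> /shadow_in_tower /(in_tower_closed tow1) [c1 [cl1 s1 z1]].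
move=> /shadow_in_tower /(in_tower_closed tow2) [c2 [cl2 s2 z2]].
have := closed_size next_det cl1 cl2 s1 s2; rewrite z1 z2 => /double_inj.
exact: size12.
Qed.

(** Following a trajectory stays in its tower. When a crossing slides along a
    side, the positions form a segment covered by two disjoint open sets, so a
    slide cannot pass from one tower to the other. When the words have the same
    length the two shadows may fail to be disjoint, hence [size12]. *)
Lemma same_strip_in_tower s s' : same_strip theta s s' -> in1 s -> in1 s'.
Proof.
elim=> {s s'} [c s s' cl sc s'c|b i t t' slide|s s' s'' _ h _ h'] //.
- exact: (closed_in_tower tow1 cl sc s'c).
- have sh r : (t <= r <= t') || (t' <= r <= t) ->
      tower_shadow w1 l1 r1 (pos v true i r) \/ tower_shadow w2 l2 r2 (pos v true i r).
    move=> /slide /closed_cover[].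
      by move=> /(in_tower_shadow tow1); left.
    by move=> /(in_tower_shadow tow2); right.
  move=> it; have tt' : (t <= t' <= t') || (t' <= t' <= t).
    by rewrite !lexx andbT /= le_total.
  have /closed_cover[//|/(in_tower_shadow tow2) /= sh2] := slide _ tt'.
  have /= sh1 := in_tower_shadow tow1 it.
  pose a := Num.min t t'; pose b' := Num.max t t'.
  have in_ab r : a <= r <= b' -> (t <= r <= t') || (t' <= r <= t).
    by rewrite /a /b'; case: (leP t t') => _ ->; rewrite ?orbT.
  have ta : a <= t <= b' by rewrite /a /b' ge_min le_max !lexx.
  have ta' : a <= t' <= b' by rewrite /a /b' ge_min le_max !lexx !orbT.
  have cov r : a <= r <= b' -> [set t | tower_shadow w1 l1 r1 (pos v true i t)] r \/
      [set t | tower_shadow w2 l2 r2 (pos v true i t)] r by move=> /in_ab /sh.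
  have dis r : a <= r <= b' -> [set t | tower_shadow w1 l1 r1 (pos v true i t)] r ->
      [set t | tower_shadow w2 l2 r2 (pos v true i t)] r -> False.
    by move=> _; exact: shadows_disjoint.
  exfalso; apply: (shadows_disjoint _ sh2).
  exact: (segment_separation (@tower_shadow_open w1 l1 r1 i)
    (@tower_shadow_open w2 l2 r2 i)
    cov dis ta ta' sh1).
- by move=> /h /h'.
Qed.

End TwoTowers.

Variables (w1 w2 : seq piece) (l1 r1 l2 r2 : R).
Hypothesis tt : two_towers f v w1 l1 r1 w2 l2 r2.
Local Notation in1 := (in_tower w1 l1 r1).
Local Notation in2 := (in_tower w2 l2 r2).
Let tow1 := short_tower tt.
Let tow2 := long_tower tt.

(** Followed forwards, the trajectory reaches the base of a tower; as the tower
    consists of closed trajectories, going back along it does not leave the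
    tower. *)
Lemma forward_cover (T : set (crossing R)) :
  (forall s, T s -> exists2 s', next s s' & T s') -> forall s, T s -> in1 s \/ in2 s.
Proof.
move=> fwd.
pose S x := [/\ 0 < x < W, x != bottom & T (lower x)].
have invS : invariant len S.
  move=> x [xW xc Tx]; have [s1 n1 T1] := fwd _ Tx; have [s2 n2 T2] := fwd _ T1.
  have [L onL e2] := next_lower xW xc n1 n2; exists L => //.
  split; [exact: (shift_range len_ge0 onL)|exact: (shift_neq_bottom onL)|].
  by rewrite -e2.
have back s x : S x -> (forall c, closed_trajectory theta c -> lower x \in c -> s \in c) ->
    in1 s \/ in2 s.
  move=> Sx sc; have [xW xc Tx] := Sx.
  have [u fu u_in] := towers_cover tt invS Sx.
  have px := path_orbit_after fu xc.
  have key w l r : tower len w l r -> l < x + shifts len u < r -> in_tower w l r s.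
    move=> tow y_in; exists (x + shifts len u) => //.
    have cl := tower_closed tow y_in; apply: sc => //.
    apply: (closed_path next_codet cl px).
    rewrite last_orbit_after; case: tow => + _ _ _ _.
    by case: (w) => //= *; rewrite mem_head.
  by case: u_in => y_in; [left|right]; apply: key y_in.
move=> s Ts; have [s1 n1 T1] := fwd s Ts; have [s2 n2 T2] := fwd s1 T1.
have [s_true|s_false] := boolP s.1.1.
  have [xW xc e] := lower_coord s_true n1.
  by apply: (back s (coord s)) => [|c _]; [split=> //|]; rewrite -e.
have s1_true : s1.1.1 = true.
  move: n1 s_false; case: (s) (s1) => [[b i] t] [[b' i'] t'] /=.
  by move=> /next_crossingE[_ _ -> _ _].
have [xW xc e] := lower_coord s1_true n2.
apply: (back s (coord s1)) => [|c cl]; first by split=> //; rewrite -e.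
by rewrite -e => s1c; exact: (closed_prev next_codet cl s1c n1).
Qed.

Lemma closed_cover s : on_closed_trajectory theta s -> in1 s \/ in2 s.
Proof.
case=> c cl sc; apply: (@forward_cover [set s | s \in c]) => //= s' s'c.
exact: closed_succ cl s'c.
Qed.

Lemma two_strips_in S1 S2 : two_strips theta S1 S2 -> 
  (exists2 s, S1 s & in1 s) /\ (exists2 s, S2 s & in2 s) \/
  (exists2 s, S1 s & in2 s) /\ (exists2 s, S2 s & in1 s).
Proof.
case=> -[s1 cl1 e1] [s2 cl2 e2] S12 _.
have refl s : on_closed_trajectory theta s -> same_strip theta s s.
  by case=> c cl sc; exact: (same_strip_follow cl sc sc).
have S1s : S1 s1 by rewrite e1; exact: refl.
have S2s : S2 s2 by rewrite e2; exact: refl.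
have same w l r : tower len w l r -> in_tower w l r s1 -> in_tower w l r s2 -> S1 = S2.
  move=> tow i1 i2; have ss := tower_same_strip tow i1 i2.
  rewrite e1 e2; apply/seteqP; split=> s /= h.
    exact: same_strip_trans (same_strip_sym ss) h.
  exact: same_strip_trans ss h.
have [i1|i1] := closed_cover cl1; have [i2|i2] := closed_cover cl2.
- by case: S12; exact: same i1 i2.
- by left; split; [exists s1|exists s2].
- by right; split; [exists s1|exists s2].
- by case: S12; exact: same i1 i2.
Qed.

Lemma strip_period_in num S m s : strip theta S -> strip_period num theta S m ->
  size w1 <> size w2 -> S s -> 
  (in1 s -> m = period num (size w1)) /\ (in2 s -> m = period num (size w2)).
Proof.
move=> [s0 cl0 eS] [c [cl cS wp]] s12 Ss.
have [s' s'c] : exists s', s' \in c.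
  by case: cl => + _ _; case: (c) => // s' *; exists s'; rewrite mem_head.
have ss : same_strip theta s s'.
  have h := cS _ s'c; rewrite eS /= in h; rewrite eS /= in Ss.
  exact: same_strip_trans (same_strip_sym Ss) h.
have fin w' l' r' : tower len w' l' r' -> in_tower w' l' r' s' -> m = period num (size w').
  move=> tow /(in_tower_closed tow) [c' [cl' s'c' sz]].
  apply: word_period_size wp _; rewrite size_map -sz.
  exact: (closed_size next_det cl cl' s'c s'c').
split=> i1.
  exact: (fin _ _ _ tow1 (same_strip_in_tower tow1 tow2 s12 closed_cover ss i1)).
apply: (fin _ _ _ tow2); apply: (same_strip_in_tower tow2 tow1 _ _ ss i1).
  by move=> e; apply: s12.
by move=> s1 /closed_cover[]; [right|left].
Qed.

(** If the two words have the same length, all closed trajectories have this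
    length. Otherwise each strip lies in one tower, and the order of the periods
    tells in which one. *)
Lemma periods_unique num S1 S2 m n : two_strips theta S1 S2 ->
  strip_period num theta S1 m -> strip_period num theta S2 n ->
  (m <= n)%N -> (size w1 <= size w2)%N ->
  m = period num (size w1) /\ n = period num (size w2).
Proof.
move=> ts p1 p2 mn w12; have [st1 st2 _ _] := ts.
have [e12|/eqP ne12] := eqVneq (size w1) (size w2).
  have any S k : strip_period num theta S k -> k = period num (size w1).
    case=> c [cl _ wp]; have [s sc] : exists s, s \in c.
      by case: cl => + _ _; case: (c) => // s *; exists s; rewrite mem_head.
    have on : on_closed_trajectory theta s by exists c.
    apply: word_period_size wp _; rewrite size_map.
    case: (closed_cover on) => [/(in_tower_closed tow1)|/(in_tower_closed tow2)];
      case=> c' [cl' sc' sz]; rewrite (closed_size next_det cl cl' sc sc') sz //.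
    by rewrite e12.
  by rewrite -e12 (any _ _ p1) (any _ _ p2).
have [[[s1 h1 i1] [s2 h2 i2]]|[[s1 h1 i1] [s2 h2 i2]]] := two_strips_in ts.
  by split; [exact: (strip_period_in st1 p1 ne12 h1).1|exact: (strip_period_in st2 p2 ne12 h2).2].
have em := (strip_period_in st1 p1 ne12 h1).2 i1.
have en := (strip_period_in st2 p2 ne12 h2).1 i2.
have := leq_period num w12; rewrite -em -en => nm.
have e : m = n by apply/eqP; rewrite eqn_leq mn.
by split; [rewrite e|rewrite -e].
Qed.

Lemma periods_exist num : (size w1 < size w2)%N -> exists S1 S2,
  [/\ two_strips theta S1 S2, strip_period num theta S1 (period num (size w1)) &
      strip_period num theta S2 (period num (size w2))].
Proof.
move=> w12; have s12 : size w1 <> size w2 by move=> e; rewrite e ltnn in w12.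
have pick w l r : tower len w l r -> exists x, [/\ l < x < r, follows len w x,
    closed_trajectory theta (orbit_from w x) & lower x \in orbit_from w x].
  move=> tow; have x_in : l < (l + r) / 2 < r by case: tow => *; lra.
  exists ((l + r) / 2); case: (tow) => w0 _ _ _ fol; split=> //; first exact: fol.
    exact: (tower_closed tow x_in).
  by case: (w) w0 => //= *; rewrite mem_head.
have [x1 [x1_in f1 cl1 m1]] := pick _ _ _ tow1.
have [x2 [x2_in f2 cl2 m2]] := pick _ _ _ tow2.
have i1 : in1 (lower x1) by exists x1.
have i2 : in2 (lower x2) by exists x2.
pose S x := [set s | same_strip theta (lower x) s].
have stripS w x : closed_trajectory theta (orbit_from w x) -> lower x \in orbit_from w x ->
    strip theta (S x).
  by move=> cl m; exists (lower x) => //; exists (orbit_from w x).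
have periodS w x : closed_trajectory theta (orbit_from w x) -> lower x \in orbit_from w x ->
    follows len w x -> strip_period num theta (S x) (period num (size w)).
  move=> cl m fw; exists (orbit_from w x); split=> //; last exact: orbit_word_period.
  by move=> s sx; exact: (same_strip_follow cl m sx).
exists (S x1), (S x2); split; [split| |].
- exact: (stripS _ _ cl1 m1).
- exact: (stripS _ _ cl2 m2).
- move=> eS; have S2 : S x1 (lower x2).
    by rewrite eS; exact: (same_strip_follow cl2 m2 m2).
  have j1 : in1 (lower x2).
    exact: (same_strip_in_tower tow1 tow2 s12 closed_cover S2 i1).
  have [c [cl mc sc]] := in_tower_closed tow1 j1.
  have [c' [cl' mc' sc']] := in_tower_closed tow2 i2.
  have := closed_size next_det cl cl' mc mc'; rewrite sc sc' => /double_inj.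
  exact: s12.
- move=> s chain.
  have : in1 (s 0%N) \/ in2 (s 0%N).
    apply: (@forward_cover [set s' | exists n, s' = s n]); last by exists 0%N.
    by move=> _ [n ->]; exists (s n.+1) => //; exists n.+1.
  case=> i; [left|right].
    exact: (tower_same_strip tow1 i1 i).
  exact: (tower_same_strip tow2 i2 i).
- exact: (periodS _ _ cl1 m1 f1).
- exact: (periodS _ _ cl2 m2 f2).
Qed.

End Direction.
End Crossings.

(** * Pairs of periods in the third sector *)

(** The exponent of 5 is odd on the left and even on the right. *)
Lemma five_sq (n k : nat) : (5 * n ^ 2 = k ^ 2)%N -> n = 0%N.
Proof.
move=> e; apply/eqP; rewrite -leqn0 leqNgt; apply/negP => n0.
have k0 : (0 < k)%N by case: k e => //; case: n n0.
have := congr1 (logn 5) e; rewrite lognM ?expn_gt0 ?n0 // !lognX (logn_prime _ (isT : prime 5)).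
by move=> /(congr1 odd); rewrite !mul2n oddD !odd_double.
Qed.

Section PairsOfPeriods.
Variable R : realType.
Local Notation f := (phi R).

(** As 2 phi - 1 is the square root of 5, a rational value of phi contradicts
    [five_sq]. *)
Lemma phi_indep (a b c d : nat) : f * a%:R + b%:R = f * c%:R + d%:R ->
  a = c /\ b = d.
Proof.
move=> e; have ff := phi_sq R.
have key (m n : int) : f * m%:~R = n%:~R -> m = 0.
  move=> e1.
  have e2 : ((2 * n - m) ^+ 2)%:~R = (5 * m ^+ 2)%:~R :> R.
    rewrite !(rmorphXn, rmorphM, rmorphB) /= -e1.
    have -> : (2%:~R * (f * m%:~R) - m%:~R) ^+ 2 = (4 * (f * f) - 4 * f + 1) * m%:~R ^+ 2 :> R.
      by ring.
    by rewrite ff; ring.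
  have e3 : (2 * n - m) ^+ 2 = 5 * m ^+ 2 by apply/eqP; rewrite -(eqr_int R); apply/eqP.
  have := congr1 absz e3; rewrite abszX abszM abszX => /esym /five_sq.
  by move/eqP; rewrite absz_eq0 => /eqP.
have e0 : f * ((a%:Z - c%:Z)%:~R) = (d%:Z - b%:Z)%:~R :> R.
  by rewrite !rmorphB /= -!pmulrn; lra.
have ac : a = c by have := key _ _ e0; lia.
split=> //; move: e; rewrite ac => /addrI /eqP; rewrite eqr_nat => /eqP; exact.
Qed.

Lemma disp_counts w : exists a b c d : nat,
  [/\ (disp f w).1 = f * c%:R + d%:R, (disp f w).2 = f * b%:R + a%:R &
      size w = (a + b + c + d)%N].
Proof.
elim: w => [|L w [a [b [c [d [e1 e2 sz]]]]]].
  by exists 0%N, 0%N, 0%N, 0%N; rewrite disp_nil /=; split=> //; ring.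
have -> : disp f (L :: w) = ((disp f [:: L]).1 + (disp f w).1, (disp f [:: L]).2 + (disp f w).2).
  by rewrite -disp_cat.
rewrite e1 e2 /= sz /disp !big_cons !big_nil.
case: L; [exists a.+1, b, c, d|exists a, b.+1, c, d|exists a, b, c.+1, d|exists a, b, c, d.+1];
  by split; rewrite ?(addnS, addSn) // -?natr1; ring.
Qed.

(** The numbers of visits to the four pieces are the coefficients of the
    displacement over Z[phi]. *)
Lemma size_of_disp w u1 u2 :
  disp f w = ((disp f u1).1 + (disp f u2).1, (disp f u1).2 + (disp f u2).2) ->
  size w = (size u1 + size u2)%N.
Proof.
have [a [b [c [d [e1 e2 ->]]]]] := disp_counts w.
have [a1 [b1 [c1 [d1 [e11 e21 ->]]]]] := disp_counts u1.
have [a2 [b2 [c2 [d2 [e12 e22 ->]]]]] := disp_counts u2.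
rewrite [disp f w]surjective_pairing e1 e2 e11 e21 e12 e22 => -[h1 h2].
have [] : c = (c1 + c2)%N /\ d = (d1 + d2)%N by apply: phi_indep; rewrite !natrD h1; ring.
have [] : b = (b1 + b2)%N /\ a = (a1 + a2)%N by apply: phi_indep; rewrite !natrD h2; ring.
by lia.
Qed.

(** Multiplication by phi sends c phi + d to (c + d) phi + c, which increases the
    sum of the coefficients by c. *)
Lemma size_le_of_disp w u : disp f u = (f * (disp f w).1, f * (disp f w).2) ->
  (size w <= size u)%N.
Proof.
have ff := phi_sq R.
have [a [b [c [d [e1 e2 ->]]]]] := disp_counts w.
have [a1 [b1 [c1 [d1 [e11 e21 ->]]]]] := disp_counts u.
rewrite [disp f u]surjective_pairing e1 e2 e11 e21 => -[h1 h2].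
have [] : c1 = (c + d)%N /\ d1 = c.
  by apply: phi_indep; rewrite !natrD h1 mulrDr mulrA ff; ring.
have [] : b1 = (b + a)%N /\ a1 = b.
  by apply: phi_indep; rewrite !natrD h2 mulrDr mulrA ff; ring.
by lia.
Qed.

(** The boundary point of the direction of v. *)
Definition bpoint (v : R * R) : boundary R :=
  if v.1 + v.2 == 0 then None
  else Some ((1 - f / 2) * ((v.2 - v.1) / (v.1 + v.2))).

Definition in_sector (v : R * R) : Prop := [/\ 0 <= v.1, 0 <= v.2 & 0 < v.1 + v.2].

Lemma sin36_neq0 : sin (pi / 5) != 0 :> R.
Proof.
apply/eqP => s0; have := sin36_cot72 R; rewrite s0 mul0r.
by have := phi_bounds R; lra.
Qed.

Lemma directed_bpoint (theta : R) (v : R * R) : in_sector v ->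
  0 <= theta < pi -> boundary_point theta = bpoint v -> directed theta v.
Proof.
move=> [v1 v2 v12] th; rewrite /boundary_point /bpoint (gt_eqF v12).
have [//|s0 [e]] := eqVneq (sin theta) 0.
have s_gt0 : 0 < sin theta.
  by rewrite lt_neqAle eq_sym s0 sin_ge0_pi //; lra.
have S_gt0 := sin72_gt0 R; have S0 : sin (2 * pi / 5) != 0 :> R by rewrite gt_eqF.
have V0 : v.1 + v.2 != 0 by rewrite gt_eqF.
split=> //; exists (sin theta / ((v.1 + v.2) * sin (2 * pi / 5))).
  by rewrite divr_gt0 // mulr_gt0.
have eC : cos theta / sin theta =
    (v.1 - v.2) / (v.1 + v.2) * (cos (2 * pi / 5) / sin (2 * pi / 5)).
  apply: (mulfI sin36_neq0); rewrite -[LHS]opprK e -(sin36_cot72 R).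
  by field; rewrite S0 V0.
have {}eC : cos theta = (v.1 - v.2) / (v.1 + v.2) * (cos (2 * pi / 5) / sin (2 * pi / 5)) * sin theta.
  by rewrite -eC divfK.
apply/rowP => i; rewrite !mxE; case: ifP => _.
  by rewrite eC; field; rewrite S0 V0.
by field; rewrite S0 V0.
Qed.

Lemma exists_theta (v : R * R) : in_sector v ->
  exists2 theta, 0 <= theta < pi & boundary_point theta = bpoint v.
Proof.
move=> [v1 v2 v12]; have S_gt0 := sin72_gt0 R.
have S0 : sin (2 * pi / 5) != 0 :> R by rewrite gt_eqF.
have V0 : v.1 + v.2 != 0 by rewrite gt_eqF.
pose X := (v.1 - v.2) * cos (2 * pi / 5); pose Y := (v.1 + v.2) * sin (2 * pi / 5).
have Y_gt0 : 0 < Y by exact: mulr_gt0.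
pose r := Num.sqrt (X ^+ 2 + Y ^+ 2).
have r2 : r ^+ 2 = X ^+ 2 + Y ^+ 2 by rewrite sqr_sqrtr // addr_ge0 ?sqr_ge0.
have r_gt0 : 0 < r by rewrite sqrtr_gt0 ltr_pwDr ?sqr_ge0 // exprn_gt0.
have r0 : r != 0 by rewrite gt_eqF.
have Xr : -1 < X / r < 1.
  rewrite ltr_pdivlMr // ltr_pdivrMr // mulN1r mul1r -ltr_norml.
  by rewrite -ltr_sqr ?nnegrE ?(ltW r_gt0) // real_normK ?num_real // r2 ltrDl exprn_gt0.
have Xr' : -1 <= X / r <= 1 by lra.
exists (acos (X / r)).
  by rewrite acos_ge0 // acos_ltpi //; lra.
have cE : cos (acos (X / r)) = X / r by apply: acosK; rewrite in_itv.
have sE : sin (acos (X / r)) = Y / r.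
  rewrite sin_acos //; have -> : 1 - (X / r) ^+ 2 = (Y / r) ^+ 2.
    by rewrite !expr_div_n r2; field; rewrite -r2 expf_neq0.
  by rewrite sqrtr_sqr ger0_norm // divr_ge0 ?ltW.
rewrite /boundary_point /bpoint sE cE gt_eqF ?divr_gt0 // gt_eqF //.
congr Some; rewrite -(sin36_cot72 R) /X /Y.
by field; rewrite S0 V0 r0.
Qed.

Lemma pair_of_periods_unique num (v : R * R) a A w1 l1 r1 w2 l2 r2 :
  in_sector v -> two_towers f v w1 l1 r1 w2 l2 r2 ->
  pair_of_periods num (bpoint v) a A ->
  a = period num (size w1) /\ A = period num (size w2).
Proof.
move=> nv tt [aA [theta [th e [S1 [S2 [ts p1 p2]]]]]].
have dir := directed_bpoint nv th e.
apply: (periods_unique dir tt ts p1 p2 aA).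
by apply: size_le_of_disp; rewrite (short_disp tt) (long_disp tt).
Qed.

Lemma pair_of_periods_exist num (v : R * R) w1 l1 r1 w2 l2 r2 :
  in_sector v -> two_towers f v w1 l1 r1 w2 l2 r2 ->
  (size w1 < size w2)%N ->
  pair_of_periods num (bpoint v) (period num (size w1)) (period num (size w2)).
Proof.
move=> nv tt w12; split; first by apply: leq_period; exact: ltnW.
have [theta th e] := exists_theta nv.
exists theta; split=> //.
exact: (periods_exist (directed_bpoint nv th e) tt).
Qed.

Definition lin (a b : R) (x y : R * R) : R * R := (a * x.1 + b * y.1, a * x.2 + b * y.2).

(** Each period is that of a strip whose displacement is a sum of displacements of
    strips in the directions x and y, by phi ^ 2 = phi + 1. The periods of these
    strips are positive, so the two periods differ and the first is the smaller
    one. *)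
Lemma pairs_of_periods_combine num (x y : R * R) a A b B :
  in_sector x -> in_sector y ->
  decomposes f x -> decomposes f y ->
  decomposes f (lin f 1 x y) -> decomposes f (lin f f x y) -> decomposes f (lin 1 f x y) ->
  pair_of_periods num (bpoint x) a A -> pair_of_periods num (bpoint y) b B ->
  [/\ pair_of_periods num (bpoint (lin f 1 x y)) (b + A) (a + A + B),
      pair_of_periods num (bpoint (lin f f x y)) (A + B) (a + b + A + B) &
      pair_of_periods num (bpoint (lin 1 f x y)) (a + B) (b + A + B)].
Proof.
have ff := phi_sq R; have f0 := phi_gt0 R; have fb := phi_bounds R.
move=> nx ny; have [[x1 x2 x12] [y1 y2 y12]] := (nx, ny).
move=> [u1 [l1 [r1 [u2 [l2 [r2 tx]]]]]] [v1 [l3 [r3 [v2 [l4 [r4 ty]]]]]].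
move=> [p1 [l5 [r5 [p2 [l6 [r6 tp]]]]]] [q1 [l7 [r7 [q2 [l8 [r8 tq]]]]]].
move=> [s1 [l9 [r9 [s2 [l10 [r10 ts]]]]]].
move=> /(pair_of_periods_unique nx tx)[-> ->].
move=> /(pair_of_periods_unique ny ty)[-> ->].
have nonempty w l r z : tower (lengths f z) w l r -> (0 < size w)%N.
  by case=> + _ _ _ _; case: w.
have u1_gt0 := nonempty _ _ _ _ (short_tower tx).
have v1_gt0 := nonempty _ _ _ _ (short_tower ty).
have dx1 := short_disp tx; have dx2 := long_disp tx.
have dy1 := short_disp ty; have dy2 := long_disp ty.
have u12 : (size u1 <= size u2)%N by apply: size_le_of_disp; rewrite dx1 dx2.
have v12 : (size v1 <= size v2)%N by apply: size_le_of_disp; rewrite dy1 dy2.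
have sp1 : size p1 = (size v1 + size u2)%N.
  apply: size_of_disp; rewrite (short_disp tp) dx2 dy1 /lin /=; by congr pair; ring.
have sp2 : size p2 = (size (u1 ++ u2) + size v2)%N.
  apply: size_of_disp; rewrite disp_cat (long_disp tp) dx1 dx2 dy2 /lin /=.
  by congr pair; ring: ff.
have sq1 : size q1 = (size u2 + size v2)%N.
  by apply: size_of_disp; rewrite (short_disp tq) dx2 dy2 /lin.
have sq2 : size q2 = (size (u1 ++ v1) + size (u2 ++ v2))%N.
  apply: size_of_disp; rewrite !disp_cat (long_disp tq) dx1 dx2 dy1 dy2 /lin /=.
  by congr pair; ring: ff.
have ss1 : size s1 = (size u1 + size v2)%N.
  apply: size_of_disp; rewrite (short_disp ts) dx1 dy2 /lin /=; by congr pair; ring.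
have ss2 : size s2 = (size (v1 ++ u2) + size v2)%N.
  apply: size_of_disp; rewrite disp_cat (long_disp ts) dx2 dy1 dy2 /lin /=.
  by congr pair; ring: ff.
rewrite !size_cat in sp2 sq2 ss2.
have fx1 := mulr_ge0 (ltW f0) x1; have fx2 := mulr_ge0 (ltW f0) x2.
have fy1 := mulr_ge0 (ltW f0) y1; have fy2 := mulr_ge0 (ltW f0) y2.
have fx12 := mulr_gt0 f0 x12; have fy12 := mulr_gt0 f0 y12.
have lp : (size p1 < size p2)%N by rewrite sp1 sp2; clear -u1_gt0 v1_gt0 u12 v12; lia.
have lq : (size q1 < size q2)%N by rewrite sq1 sq2; clear -u1_gt0 v1_gt0 u12 v12; lia.
have ls : (size s1 < size s2)%N by rewrite ss1 ss2; clear -u1_gt0 v1_gt0 u12 v12; lia.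
have P1 : (period num (size v1) + period num (size u2))%N = period num (size p1).
  by rewrite sp1 periodD.
have P2 : (period num (size u1) + period num (size u2) + period num (size v2))%N =
    period num (size p2) by rewrite sp2 !periodD.
have Q1 : (period num (size u2) + period num (size v2))%N = period num (size q1).
  by rewrite sq1 periodD.
have Q2 : (period num (size u1) + period num (size v1) + period num (size u2) +
    period num (size v2))%N = period num (size q2) by rewrite sq2 !periodD addnA.
have S1 : (period num (size u1) + period num (size v2))%N = period num (size s1).
  by rewrite ss1 periodD.
have S2 : (period num (size v1) + period num (size u2) + period num (size v2))%N =
    period num (size s2) by rewrite ss2 !periodD.
rewrite P2 S2 Q2 P1 Q1 S1; split.
- by apply: (pair_of_periods_exist _ _ tp lp); rewrite /in_sector /lin /=; split; lra.
- by apply: (pair_of_periods_exist _ _ tq lq); rewrite /in_sector /lin /=; split; lra.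
- by apply: (pair_of_periods_exist _ _ ts ls); rewrite /in_sector /lin /=; split; lra.
Qed.

End PairsOfPeriods.

(** * Ideal pentagons as fans of vectors *)

Section Hyperbolic.
Variable R : realType.
Local Notation f := (phi R).

Definition det2 (x y : R * R) : R := x.1 * y.2 - x.2 * y.1.

(** The point of the projective line with homogeneous coordinates (n : d). *)
Definition hpoint (n d : R) : boundary R := if d == 0 then None else Some (n / d).

(** The reflection is the projective involution that fixes its two ends. With
    these as the basis, it changes the sign of one homogeneous coordinate. The
    cases correspond to the points that may be infinite. *)
Lemma reflection_hpoint (n1 d1 n2 d2 a b : R) :
  n1 * d2 - n2 * d1 != 0 -> (a != 0) || (b != 0) ->
  reflection (hpoint n1 d1) (hpoint n2 d2) (hpoint (a * n1 + b * n2) (a * d1 + b * d2)) =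
  hpoint (a * n1 - b * n2) (a * d1 - b * d2).
Proof.
rewrite /hpoint => D0 ab.
have [d10|d10] := eqVneq d1 0.
  rewrite d10 !mulr0 !add0r subr0 in D0 *.
  have d20 : d2 != 0 by apply: contraNneq D0 => ->; rewrite mulr0.
  rewrite oppr_eq0 mulf_eq0 (negbTE d20) orbF.
  have [//|b0] /= := eqVneq b 0; congr Some; field.
  by rewrite d20 b0.
have [d20|d20] := eqVneq d2 0.
  rewrite d20 !mulr0 addr0 subr0 mulf_eq0 (negbTE d10) orbF.
  by have [//|a0] /= := eqVneq a 0; congr Some; field; rewrite a0 d10.
have uv : n1 / d1 - n2 / d2 != 0.
  apply: contraNneq D0 => /(congr1 ( *%R (d1 * d2))); rewrite mulr0 => <-; apply/eqP; field.
  by rewrite d10 d20.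
rewrite /reflection.
have [e|s0] := eqVneq (a * d1 + b * d2) 0.
  have eb : b = - (a * d1) / d2.
    by apply: (mulIf d20); rewrite divfK //; lra.
  have a0 : a != 0 by apply: contraTneq ab => a0; rewrite eb a0 mul0r oppr0 mul0r eqxx.
  have -> : a * d1 - b * d2 = 2 * (a * d1) by lra.
  rewrite mulf_eq0 pnatr_eq0 /= mulf_eq0 (negbTE a0) (negbTE d10) /=.
  by congr Some; rewrite eb; field; rewrite a0 d10 d20.
have yE : (a * n1 + b * n2) / (a * d1 + b * d2) - (n1 / d1 + n2 / d2) / 2 =
    (n1 / d1 - n2 / d2) * (a * d1 - b * d2) / (2 * (a * d1 + b * d2)).
  by field; rewrite s0 d10 d20.
rewrite -subr_eq0 yE mulf_eq0 invr_eq0 [2 * _ == 0]mulf_eq0 pnatr_eq0 (negbTE s0) /= orbF.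
rewrite mulf_eq0 (negbTE uv) /=.
have [//|t0] := eqVneq (a * d1 - b * d2) 0.
congr Some; field.
by rewrite t0 s0 d20 d10 mulNr.
Qed.

Lemma bpointE (v : R * R) : bpoint v = hpoint ((1 - f / 2) * (v.2 - v.1)) (v.1 + v.2).
Proof. by rewrite /bpoint /hpoint mulrA. Qed.

Lemma bpointN (v : R * R) : bpoint (- v) = bpoint v.
Proof.
rewrite /bpoint /= -opprD oppr_eq0; case: eqVneq => // v0; congr Some.
by field.
Qed.

(** The direction of v depends on v by a projective map. *)
Lemma reflection_bpoint (x y : R * R) (a b : R) : det2 x y != 0 -> (a != 0) || (b != 0) ->
  reflection (bpoint x) (bpoint y) (bpoint (lin a b x y)) = bpoint (lin a (- b) x y).
Proof.
move=> D ab; have fb := phi_bounds R.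
have D' : (1 - f / 2) * (x.2 - x.1) * (y.1 + y.2) - (1 - f / 2) * (y.2 - y.1) * (x.1 + x.2) != 0.
  have -> : (1 - f / 2) * (x.2 - x.1) * (y.1 + y.2) - (1 - f / 2) * (y.2 - y.1) * (x.1 + x.2) =
    (f - 2) * det2 x y by rewrite /det2; field.
  by rewrite mulf_neq0 //; apply/eqP; lra.
rewrite !bpointE /lin /=; have := reflection_hpoint D' ab.
congr (reflection _ _ (hpoint _ _) = hpoint _ _); ring.
Qed.

Lemma pair_eq (u v : R * R) : u.1 = v.1 -> u.2 = v.2 -> u = v.
Proof. by case: u v => ? ? [? ?] /= -> ->. Qed.

(** The sequences of coefficients satisfy g (m + 2) = phi g (m + 1) - g m; such a
    sequence changes its sign after five steps. *)
Definition fan_x (m : nat) : R := nth 0 [:: 1; f; f; 1; 0] m.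
Definition fan_y (m : nat) : R := nth 0 [:: 0; 1; f; f; 1] m.
Definition fan (m : nat) (x y : R * R) : R * R := lin (fan_x m) (fan_y m) x y.

Lemma fan0 x y : fan 0 x y = x.
Proof. by case: x => a b; rewrite /fan /lin /fan_x /fan_y /=; congr pair; ring. Qed.

Lemma fan4 x y : fan 4 x y = y.
Proof. by case: y => a b; rewrite /fan /lin /fan_x /fan_y /=; congr pair; ring. Qed.

(** From the vertex number j + 1 on, the vertices are the directions of the fan of
    x and y; the side j joins the directions of y and x. *)
Definition framed (Q : ideal_pentagon R) (j : nat) (x y : R * R) : Prop :=
  forall m, (m < 5)%N -> nth None Q ((j + 1 + m) %% 5) = bpoint (fan m x y).

Lemma framed_ext Q Q' j x y : framed Q j x y -> framed Q' j x y -> Q = Q'.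
Proof.
move=> F F'; apply/val_inj/(@eq_from_nth _ None); rewrite ?size_tuple // => i i5.
have [m m5 ->] : exists2 m, (m < 5)%N & i = ((j + 1 + m) %% 5)%N.
  by exists ((i + 4 * (j + 1)) %% 5)%N; [lia|lia].
by rewrite F // F'.
Qed.

Lemma framed_end Q (j : 'I_5) x y : framed Q j x y ->
  tnth Q j = bpoint y /\ tnth Q (ordS j) = bpoint x.
Proof.
move=> F; rewrite !(tnth_nth None) /=; split.
  rewrite -(fan4 x y) -F //; congr nth; have := ltn_ord j; lia.
by rewrite -(fan0 x y) -F //; congr nth; lia.
Qed.

(** Across the side j lies the pentagon with the fan of x and - y, since the
    reflection changes the sign of the y coordinate. *)
Lemma framed_reflect Q (j : 'I_5) x y : framed Q j x (- y) -> det2 x y != 0 ->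
  framed (reflect_pentagon Q j) j x y.
Proof.
move=> F D m m5; have [ey ex] := framed_end F.
rewrite /= (nth_map None) ?size_tuple ?ltn_pmod // F // ey ex bpointN.
have -> : fan m x (- y) = lin (- fan_y m) (fan_x m) y x.
  by rewrite /fan /lin /=; congr pair; ring.
rewrite reflection_bpoint; last 2 first.
- by move: D; rewrite /det2 -oppr_eq0; congr (_ != 0); ring.
- have fb := phi_bounds R.
  by case: m m5 => [|[|[|[|[|//]]]]] _; rewrite /fan_x /fan_y /= ?oppr_eq0;
    apply/orP; first [by left; apply/eqP; lra | by right; apply/eqP; lra].
by rewrite -bpointN; congr bpoint; apply: pair_eq; rewrite /fan /lin /=; ring.
Qed.

(** A pentagon can be described from any of its sides: by the recurrence, the fan
    spanned by a vector and the opposite of the preceding one runs through the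
    same directions, starting later. *)
Lemma framed_shift Q j x y m : framed Q j x y -> (m < 4)%N ->
  framed Q ((j + 1 + m) %% 5) (fan m.+1 x y) (- fan m x y).
Proof.
move=> F m4 m' m5; have ff := phi_sq R.
have -> : (((j + 1 + m) %% 5 + 1 + m') %% 5 = (j + 1 + (m + 1 + m') %% 5) %% 5)%N by lia.
rewrite F ?ltn_pmod //.
have [lt5|ge5] := ltnP (m + 1 + m') 5.
  rewrite modn_small //; congr bpoint.
  by case: m m4 lt5 => [|[|[|[|//]]]] _; case: m' m5 => [|[|[|[|[|//]]]]] _ //= _;
    apply: pair_eq; rewrite /fan /lin /fan_x /fan_y /=; ring: ff.
have -> : ((m + 1 + m') %% 5 = m + m' - 4)%N by lia.
rewrite -bpointN; congr bpoint.
by case: m m4 ge5 => [|[|[|[|//]]]] _; case: m' m5 => [|[|[|[|[|//]]]]] _ //= _;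
  apply: pair_eq; rewrite /fan /lin /fan_x /fan_y /=; ring: ff.
Qed.

Lemma det2_fan x y m : (m < 4)%N -> det2 (fan m.+1 x y) (fan m x y) = - det2 x y.
Proof.
have ff := phi_sq R; case: m => [|[|[|[|//]]]] _;
  by rewrite /det2 /fan /lin /fan_x /fan_y /=; ring: ff.
Qed.

(** Describe the pentagon from its side j' and reflect it there. *)
Lemma framed_child Q j x y m (j' : 'I_5) : framed Q j x y -> det2 x y != 0 -> (m < 4)%N ->
  val j' = ((j + 1 + m) %% 5)%N ->
  framed Q j' (fan m.+1 x y) (- fan m x y) /\
  framed (reflect_pentagon Q j') j' (fan m.+1 x y) (fan m x y).
Proof.
move=> F D m4 ej; have F' := framed_shift F m4; rewrite -ej in F'.
by split=> //; apply: framed_reflect => //; rewrite det2_fan ?oppr_eq0.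
Qed.

Definition branch (mir trn : bool) (v : R * R) : R * R :=
  let g := if trn then turn f else shear f in
  if mir then swap (g (swap v)) else g v.

(** The pairs that span the fans of the pentagons of generation n + 1 in the third
    sector: up to order, the images of (e, e') under products of n of the four
    maps. *)
Inductive nested : nat -> R * R -> R * R -> Prop :=
| nested_base : nested 0 (1, 0) (0, 1)
| nested_flip n x y of nested n x y : nested n y x
| nested_branch n mir trn x y of nested n x y :
    nested n.+1 (branch mir trn x) (branch mir trn y).

Lemma fan_flip m x y : (m < 5)%N -> fan m y x = fan (4 - m) x y.
Proof.
by case: m => [|[|[|[|[|//]]]]] _; rewrite /fan /lin /fan_x /fan_y /=; congr pair; ring.
Qed.

Lemma fan_branch mir trn m x y :
  fan m (branch mir trn x) (branch mir trn y) = branch mir trn (fan m x y).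
Proof.
by case: mir; case: trn; rewrite /branch /swap /turn /shear /fan /lin /=; congr pair; ring.
Qed.

(** The four pairs of neighbours in the fan of (e, e') are its images under the
    four maps. As linear maps carry fans to fans, the same subdivision of the
    image of (e, e') under a product of n maps gives products of n + 1 maps: the
    new factor appears on the right, while [nested] adds factors on the left. *)
Lemma nested_fan n x y m : nested n x y -> (m < 4)%N ->
  nested n.+1 (fan m.+1 x y) (fan m x y).
Proof.
move=> H; elim: H m => {n x y} [m|n x y _ IH m m4|n mir trn x y _ IH m m4].
- case: m => [|[|[|[|//]]]] _.
  + have := nested_flip (nested_branch false false nested_base).
    by congr (nested 1 _ _); rewrite /branch /shear /fan /lin /fan_x /fan_y /=; congr pair; ring.
  + have := nested_flip (nested_branch false true nested_base).
    by congr (nested 1 _ _); rewrite /branch /turn /fan /lin /fan_x /fan_y /=; congr pair; ring.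
  + have := nested_flip (nested_branch true true nested_base).
    by congr (nested 1 _ _); rewrite /branch /turn /swap /fan /lin /fan_x /fan_y /=; congr pair; ring.
  + have := nested_flip (nested_branch true false nested_base).
    by congr (nested 1 _ _); rewrite /branch /shear /swap /fan /lin /fan_x /fan_y /=; congr pair; ring.
- rewrite (@fan_flip m.+1 x y) // (@fan_flip m x y); last exact: ltnW.
  have -> : (4 - m = (4 - m.+1).+1)%N by lia.
  by apply: nested_flip; apply: IH; lia.
- by rewrite !fan_branch; apply: nested_branch; exact: IH.
Qed.

Lemma branch_sector mir trn v : in_sector v -> in_sector (branch mir trn v).
Proof.
case=> v1 v2 v12; have f0 := phi_gt0 R.
have h1 := mulr_ge0 (ltW f0) v1; have h2 := mulr_ge0 (ltW f0) v2.
have h := mulr_gt0 f0 v12.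
by case: mir; case: trn; split; rewrite /branch /swap /turn /shear /=; lra.
Qed.

Lemma decomposes_branch mir trn v : in_sector v -> decomposes f v -> decomposes f (branch mir trn v).
Proof.
have f0 := phi_gt0 R; have ff := phi_sq R.
case=> v1 v2 _ g; rewrite /branch; case: mir; case: trn.
- by apply: decomposes_swap; apply: decomposes_turn => //; exact: decomposes_swap.
- by apply: decomposes_swap; apply: decomposes_shear => //; exact: decomposes_swap.
- exact: decomposes_turn.
- exact: decomposes_shear.
Qed.

Lemma det2_branch mir trn x y :
  det2 (branch mir trn x) (branch mir trn y) = det2 x y.
Proof.
have ff := phi_sq R.
by case: mir; case: trn; rewrite /det2 /branch /swap /turn /shear /=; ring: ff.
Qed.

(** All of this is preserved by the four maps. *)
Lemma nested_facts n x y : nested n x y ->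
  [/\ in_sector x, in_sector y, decomposes f x, decomposes f y & det2 x y ^+ 2 = 1].
Proof.
elim=> {n x y} [|n x y _ [px py gx gy d]|n mir trn x y _ [px py gx gy d]].
- have g := decomposes_base (phi_gt0 R); split; rewrite /in_sector /det2 /=.
  + by split; lra.
  + by split; lra.
  + exact: g.
  + exact: (decomposes_swap g).
  + by ring.
- by split=> //; rewrite -d /det2; ring.
- split; [exact: branch_sector|exact: branch_sector|exact: decomposes_branch|exact: decomposes_branch|].
  by rewrite det2_branch.
Qed.

End Hyperbolic.

(** * Uniqueness of the depth *)

Section Depth.
Variable R : realType.
Local Notation f := (phi R).
Implicit Types (x y v w : R * R) (Q : ideal_pentagon R).

Lemma nested_inv n x y : nested n x y ->
  if n is n'.+1 then exists mir trn x' y',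
    [/\ nested n' x' y', x = branch mir trn x' & y = branch mir trn y']
  else x = (1, 0) /\ y = (0, 1) \/ x = (0, 1) /\ y = (1, 0).
Proof.
elim=> {n x y} [|[|n] x y _ IH|n mir trn x y xy _]; first by left.
- by case: IH => -[-> ->]; [right|left].
- have [mir [trn [x' [y' [xy -> ->]]]]] := IH.
  by exists mir, trn, y', x'; split=> //; exact: nested_flip.
- by exists mir, trn, x, y.
Qed.

(** The image of the sector under one of the four maps: the sector is cut in four
    by the lines q = phi p, p = q and p = phi q. *)
Definition in_cone (mir trn : bool) w : Prop :=
  let a := if mir then w.2 else w.1 in let b := if mir then w.1 else w.2 in
  if trn then b <= a <= f * b else f * b <= a.

Lemma branch_cone mir trn v : in_sector v ->
  in_cone mir trn (branch mir trn v).
Proof.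
case=> v1 v2 v12; have fb := phi_bounds R; have ff := phi_sq R.
have f0 := phi_gt0 R.
have h1 : v.1 <= f * v.1 by rewrite ler_peMl //; lra.
have h2 : v.2 <= f * v.2 by rewrite ler_peMl //; lra.
have e1 : f * (f * v.1) = f * v.1 + v.1 by rewrite mulrA ff; ring.
have e2 : f * (f * v.2) = f * v.2 + v.2 by rewrite mulrA ff; ring.
by case: mir; case: trn; rewrite /in_cone /branch /swap /turn /shear /= ?mulrDr ?e1 ?e2; lra.
Qed.

Lemma cone_wall mir trn mir' trn' w : (mir, trn) != (mir', trn') ->
  0 <= w.1 -> 0 <= w.2 -> in_cone mir trn w -> in_cone mir' trn' w ->
  if mir == mir' then (if mir then w.2 = f * w.1 else w.1 = f * w.2) else w.1 = w.2.
Proof.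
move=> ne w1 w2; have fb := phi_bounds R.
have fw1 : w.1 <= f * w.1 by rewrite ler_peMl //; lra.
have fw2 : w.2 <= f * w.2 by rewrite ler_peMl //; lra.
by move: ne; rewrite /in_cone; case: mir; case: trn; case: mir'; case: trn' => //= _ *; lra.
Qed.

Lemma branch_inj mir trn : injective (@branch R mir trn).
Proof.
have fb := phi_bounds R.
have cancel_f (a b : R) : (f - 1) * a = (f - 1) * b -> a = b by apply: mulfI; apply/eqP; lra.
move=> v w; case: v w => [v1 v2] [w1 w2].
case: mir; case: trn; rewrite /branch /swap /turn /shear /= => -[h1 h2].
- have e : v2 = w2 by apply: cancel_f; lra.
  by rewrite e in h1 *; congr pair; apply: (mulfI (lt0r_neq0 (phi_gt0 R))); lra.
- by rewrite h1 in h2 *; congr pair; lra.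
- have e : v1 = w1 by apply: cancel_f; lra.
  by rewrite e in h2 *; congr pair; apply: (mulfI (lt0r_neq0 (phi_gt0 R))); lra.
- by rewrite h2 in h1 *; congr pair; lra.
Qed.

(** The first factor is determined by the cone that contains x and y, as two
    independent vectors cannot lie on a common wall of two cones. *)
Lemma nested_depth n m x y : nested n x y -> nested m x y -> n = m.
Proof.
have fb := phi_bounds R.
have base k x0 y0 x1 y1 mir trn : nested 0 x0 y0 -> nested k x1 y1 ->
    x0 = branch mir trn x1 -> y0 = branch mir trn y1 -> False.
  move=> /nested_inv bs /nested_facts[px py _ _ _] ex ey.
  have := branch_cone mir trn px; have := branch_cone mir trn py.
  rewrite -ex -ey /in_cone; case: bs => -[-> ->]; case: mir {ex ey}; case: trn => /=; lra.
elim: n m x y => [|n IH] [|m] x y h1 h2 //.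
- have [mir [trn [x1 [y1 [h ex ey]]]]] := nested_inv h2.
  by case: (base _ _ _ _ _ _ _ h1 h ex ey).
- have [mir [trn [x1 [y1 [h ex ey]]]]] := nested_inv h1.
  by case: (base _ _ _ _ _ _ _ h2 h ex ey).
have [mir [trn [x1 [y1 [h ex ey]]]]] := nested_inv h1.
have [mir' [trn' [x2 [y2 [h' ex' ey']]]]] := nested_inv h2.
have [e|ne] := eqVneq (mir, trn) (mir', trn').
  case: e ex' ey' => <- <-; rewrite ex ey => /branch_inj ex' /branch_inj ey'.
  by congr S; apply: IH h _; rewrite ex' ey'.
exfalso.
have [px1 py1 _ _ _] := nested_facts h; have [px2 py2 _ _ _] := nested_facts h'.
have [[x_1 x_2 _] [y_1 y_2 _] _ _ d] := nested_facts h1.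
have cx := branch_cone mir trn px1; have cy := branch_cone mir trn py1.
have cx' := branch_cone mir' trn' px2; have cy' := branch_cone mir' trn' py2.
rewrite -ex in cx; rewrite -ey in cy; rewrite -ex' in cx'; rewrite -ey' in cy'.
have d0 : det2 x y != 0 by apply: contra_eq_neq d => ->; rewrite expr0n eq_sym oner_eq0.
have wx := cone_wall ne x_1 x_2 cx cx'; have wy := cone_wall ne y_1 y_2 cy cy'.
apply/negP: d0; rewrite negbK /det2; apply/eqP; move: wx wy {ne cx cy cx' cy' ex ey ex' ey'}.
by case: (mir == mir'); [case: (mir)|] => -> ->; ring.
Qed.

(** The boundary point of a vector of the sector, which is finite. *)
Definition bcoord v : R := (1 - f / 2) * ((v.2 - v.1) / (v.1 + v.2)).

Lemma bpoint_coord v : in_sector v -> bpoint v = Some (bcoord v).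
Proof. by case=> _ _ v12; rewrite /bpoint gt_eqF. Qed.

Lemma bcoord_parallel v w : in_sector v -> in_sector w -> bcoord v = bcoord w ->
  exists2 k, 0 < k & w = (k * v.1, k * v.2).
Proof.
move=> [v1 v2 v12] [w1 w2 w12] e; have fb := phi_bounds R.
have m0 : 1 - f / 2 != 0 by apply/eqP; lra.
move/(mulfI m0): e => e.
have v0 : v.1 + v.2 != 0 by rewrite gt_eqF.
have w0 : w.1 + w.2 != 0 by rewrite gt_eqF.
have {}e : (v.2 - v.1) * (w.1 + w.2) = (w.2 - w.1) * (v.1 + v.2).
  by move: e => /eqP; rewrite eqr_div // => /eqP.
exists ((w.1 + w.2) / (v.1 + v.2)); first exact: divr_gt0.
apply: pair_eq => /=; apply: (mulIf v0).
  have -> : (w.1 + w.2) / (v.1 + v.2) * v.1 * (v.1 + v.2) = (w.1 + w.2) * v.1 by field.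
  lra.
have -> : (w.1 + w.2) / (v.1 + v.2) * v.2 * (v.1 + v.2) = (w.1 + w.2) * v.2 by field.
lra.
Qed.

Lemma fan_sector m x y : in_sector x -> in_sector y -> (m < 5)%N -> in_sector (fan m x y).
Proof.
have f0 := phi_gt0 R; move=> [x1 x2 x12] [y1 y2 y12].
have fx1 := mulr_ge0 (ltW f0) x1; have fx2 := mulr_ge0 (ltW f0) x2.
have fy1 := mulr_ge0 (ltW f0) y1; have fy2 := mulr_ge0 (ltW f0) y2.
have fx12 := mulr_gt0 f0 x12; have fy12 := mulr_gt0 f0 y12.
by case: m => [|[|[|[|[|//]]]]] _; split; rewrite /fan /lin /fan_x /fan_y /=; lra.
Qed.

Lemma bcoord_fan m x y : in_sector x -> in_sector y -> (m < 5)%N ->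
  exists2 t, bcoord (fan m x y) = bcoord x + t * (bcoord y - bcoord x) &
    [/\ 0 <= t, t <= 1, ((0 < m < 4)%N -> 0 < t < 1), (m = 0%N -> t = 0) & (m = 4%N -> t = 1)].
Proof.
move=> nx ny m5; have [_ _ s0] := fan_sector nx ny m5; move: nx ny => [x1 x2 x12] [y1 y2 y12].
have f0 := phi_gt0 R.
exists (fan_y R m * (y.1 + y.2) / ((fan m x y).1 + (fan m x y).2)).
  have sx : x.1 + x.2 != 0 by rewrite gt_eqF.
  have sy : y.1 + y.2 != 0 by rewrite gt_eqF.
  have s0' : (fan m x y).1 + (fan m x y).2 != 0 by rewrite gt_eqF.
  by move: s0'; rewrite /bcoord /fan /lin /= => s0'; field; rewrite s0' sx sy.
have cx : 0 <= fan_x R m /\ ((0 < m < 4)%N -> 0 < fan_x R m).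
  by case: (m) m5 => [|[|[|[|[|//]]]]] _; rewrite /fan_x /=; split=> //; lra.
have cy : 0 <= fan_y R m /\ ((0 < m < 4)%N -> 0 < fan_y R m).
  by case: (m) m5 => [|[|[|[|[|//]]]]] _; rewrite /fan_y /=; split=> //; lra.
have sE : (fan m x y).1 + (fan m x y).2 = fan_x R m * (x.1 + x.2) + fan_y R m * (y.1 + y.2).
  by rewrite /fan /lin /=; ring.
split.
- by rewrite divr_ge0 ?(ltW s0) // mulr_ge0 ?(ltW y12) //; case: cy.
- by rewrite ler_pdivrMr // mul1r sE lerDr mulr_ge0 ?(ltW x12) //; case: cx.
- move=> m4; rewrite divr_gt0 ?mulr_gt0 ?(cy.2 m4) //=.
  by rewrite ltr_pdivrMr // mul1r sE ltrDr mulr_gt0 ?(cx.2 m4).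
- by move=> ->; rewrite /fan_y /= mul0r mul0r.
- move=> m4; rewrite sE m4 /fan_x /fan_y /= mul0r add0r divff // mul1r gt_eqF //.
Qed.

Lemma bcoord_neq x y : in_sector x -> in_sector y -> det2 x y != 0 -> bcoord x != bcoord y.
Proof.
move=> nx ny; apply: contra_neq => /(bcoord_parallel nx ny)[k _ ->].
by rewrite /det2 /=; ring.
Qed.

(** A property of a vertex that does not refer to any frame, and that the ends of
    the outer side do not have. *)
Definition inner Q (i : nat) : Prop := exists a b c i1 i2,
  [/\ (i1 < 5)%N, (i2 < 5)%N, nth None Q i1 = Some a, nth None Q i2 = Some b &
      nth None Q i = Some c /\ a < c < b].

(** In the sector the boundary point is a monotone function of the slope, and the
    fan turns monotonically from x to y. *)
Lemma framed_inner Q j x y m : framed Q j x y -> in_sector x -> in_sector y ->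
  det2 x y != 0 -> (m < 5)%N -> inner Q ((j + 1 + m) %% 5) <-> (0 < m < 4)%N.
Proof.
move=> F nx ny D m5; have r0 := bcoord_neq nx ny D.
have low (s u e : R) : 0 <= s -> 0 <= u -> s * e < 0 * e -> 0 * e < u * e -> False.
  by move=> ? ? ? ?; have [h|h] := ltP 0 e; nra.
have high (s u e : R) : s <= 1 -> u <= 1 -> s * e < 1 * e -> 1 * e < u * e -> False.
  by move=> ? ? ? ?; have [h|h] := ltP 0 e; nra.
have val k : (k < 5)%N -> nth None Q ((j + 1 + k) %% 5) = Some (bcoord (fan k x y)).
  by move=> k5; rewrite F // bpoint_coord //; exact: fan_sector.
split=> [[a [b [c [i1 [i2 [i15 i25 ea eb [ec /andP[ac cb]]]]]]]]|m4].
  have idx i : (i < 5)%N -> exists2 k, (k < 5)%N & i = ((j + 1 + k) %% 5)%N.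
    by move=> i5; exists ((i + 4 * (j + 1)) %% 5)%N; lia.
  have [k1 k15 e1] := idx _ i15; have [k2 k25 e2] := idx _ i25.
  rewrite e1 val // in ea; rewrite e2 val // in eb; rewrite val // in ec.
  case: ea eb ec => ea [eb] [ec].
  have [t1 r1 [t10 t11 _ _ _]] := bcoord_fan nx ny k15.
  have [t2 r2 [t20 t21 _ _ _]] := bcoord_fan nx ny k25.
  have [t r [_ _ _ tm0 tm4]] := bcoord_fan nx ny m5.
  rewrite -ea -ec r1 r in ac; rewrite -eb -ec r2 r in cb.
  rewrite ltrD2l in ac; rewrite ltrD2l in cb.
  set D0 := bcoord y - bcoord x in ac cb.
  apply/negP => /negP m4.
  have [e|e] : m = 0%N \/ m = 4%N by lia.
    by rewrite (tm0 e) in ac cb; exact: low t10 t20 ac cb.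
  by rewrite (tm4 e) in ac cb; exact: high t11 t21 ac cb.
have [t r [_ _ t01 _ _]] := bcoord_fan nx ny m5; have {}t01 := t01 m4.
have q0 := val 0%N isT; have q4 := val 4%N isT; have qm := val m m5.
rewrite fan0 in q0; rewrite fan4 in q4; rewrite r in qm.
have i0 : ((j + 1 + 0) %% 5 < 5)%N by rewrite ltn_pmod.
have i4 : ((j + 1 + 4) %% 5 < 5)%N by rewrite ltn_pmod.
have mix (s u : R) : s < u -> s < s + t * (u - s) < u /\ s < u + t * (s - u) < u.
  move=> su; have h1 : 0 < t * (u - s) by apply: mulr_gt0; lra.
  have h2 : 0 < (1 - t) * (u - s) by apply: mulr_gt0; lra.
  by split; lra.
move: r0; rewrite neq_lt => /orP[/mix[lt _]|/mix[_ lt]].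
  by exists (bcoord x), (bcoord y), (bcoord x + t * (bcoord y - bcoord x)),
    ((j + 1 + 0) %% 5)%N, ((j + 1 + 4) %% 5)%N; split;
    [exact: i0|exact: i4|exact: q0|exact: q4|].
by exists (bcoord y), (bcoord x), (bcoord x + t * (bcoord y - bcoord x)),
  ((j + 1 + 4) %% 5)%N, ((j + 1 + 0) %% 5)%N; split;
  [exact: i4|exact: i0|exact: q4|exact: q0|].
Qed.

(** Both frames have the same outer side, since its ends are the vertices that are
    not [inner]; hence x and x2 are parallel, and so are y and y2 and also the
    middle vectors of the fans. This makes the three factors equal, and their
    common value is 1 because the determinants are 1 or -1. *)
Lemma framed_depth Q (j j2 : 'I_5) x y x2 y2 n m :
  framed Q j x y -> nested n x y -> framed Q j2 x2 y2 -> nested m x2 y2 -> n = m.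
Proof.
move=> F N F2 N2; have f0 := phi_gt0 R.
have [nx ny _ _ d] := nested_facts N; have [nx2 ny2 _ _ d2] := nested_facts N2.
have nz (k : R) : k ^+ 2 = 1 -> k != 0.
  by move=> k2; apply: contra_eq_neq k2 => ->; rewrite expr0n eq_sym oner_eq0.
have D := nz _ d; have D2 := nz _ d2.
have jj : j2 = j :> nat.
  have in1 := framed_inner F nx ny D; have in2 := framed_inner F2 nx2 ny2 D2.
  have idx i : exists2 k, (k < 5)%N & ((j2 + 1 + i) %% 5 = (j + 1 + k) %% 5)%N.
    by exists ((j2 + i + 4 * j) %% 5)%N; [rewrite ltn_pmod|]; lia.
  have [k0 k05 e0] := idx 0%N; have [k4 k45 e4] := idx 4%N.
  have n0 : ~ (0 < k0 < 4)%N by move/(in1 _ k05); rewrite -e0 => /(in2 0%N isT).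
  have n4 : ~ (0 < k4 < 4)%N by move/(in1 _ k45); rewrite -e4 => /(in2 4%N isT).
  by have := ltn_ord j; have := ltn_ord j2; clear -k05 e0 k45 e4 n0 n4; lia.
have eq_bcoord k : (k < 5)%N -> bcoord (fan k x y) = bcoord (fan k x2 y2).
  move=> k5; have := F2 _ k5; rewrite jj F // !bpoint_coord; first by case.
    exact: fan_sector.
  exact: fan_sector.
have [a a0 ex] : exists2 a, 0 < a & x2 = (a * x.1, a * x.2).
  by have := eq_bcoord 0%N isT; rewrite !fan0; exact: bcoord_parallel.
have [b b0 ey] : exists2 b, 0 < b & y2 = (b * y.1, b * y.2).
  by have := eq_bcoord 4%N isT; rewrite !fan4; exact: bcoord_parallel.
have [c c0] := bcoord_parallel (fan_sector nx ny (isT : 2 < 5)%N)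
  (fan_sector nx2 ny2 (isT : 2 < 5)%N) (eq_bcoord 2%N isT).
rewrite ex ey /fan /lin /fan_x /fan_y /= => -[e1 e2].
have h1 : (a - c) * x.1 + (b - c) * y.1 = 0.
  by apply: (mulfI (lt0r_neq0 f0)); lra.
have h2 : (a - c) * x.2 + (b - c) * y.2 = 0.
  by apply: (mulfI (lt0r_neq0 f0)); lra.
have ac : a = c.
  apply/eqP; rewrite -subr_eq0; apply/eqP/(mulIf D); rewrite mul0r /det2.
  have -> : (a - c) * (x.1 * y.2 - x.2 * y.1) =
    y.2 * ((a - c) * x.1 + (b - c) * y.1) - y.1 * ((a - c) * x.2 + (b - c) * y.2) by ring.
  by rewrite h1 h2; ring.
have bc : b = c.
  apply/eqP; rewrite -subr_eq0; apply/eqP/(mulIf D); rewrite mul0r /det2.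
  have -> : (b - c) * (x.1 * y.2 - x.2 * y.1) =
    x.1 * ((a - c) * x.2 + (b - c) * y.2) - x.2 * ((a - c) * x.1 + (b - c) * y.1) by ring.
  by rewrite h1 h2; ring.
have c1 : c = 1.
  have : c ^+ 4 = 1.
    by rewrite -[RHS]d2 -[LHS]mulr1 -[X in _ * X]d ex ey ac bc /det2 /=; ring.
  by move/eqP; rewrite pexpr_eq1 ?(ltW c0) // => /eqP.
apply: (nested_depth N); move: N2.
rewrite ex ey ac bc c1 !mul1r.
by case: (x) (y) => [? ?] [? ?].
Qed.
End Depth.

(** * Frames of all generations *)

Section Generations.
Variable R : realType.
Local Notation f := (phi R).
Implicit Types (x y v w : R * R) (Q F G : ideal_pentagon R).

(** The closure of the set of the directions outside the third sector. *)
Definition quadrant2 v : Prop := v.1 <= 0 /\ 0 <= v.2.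

Lemma framed_pentagon0 : framed (pentagon0 R) 4 (0, 1) (- (1, 0)).
Proof.
have ff := phi_sq R; have fb := phi_bounds R.
have fm0 : f - 1 != 0 by apply/eqP; lra.
have key : (1 - f / 2) * ((f + 1) / (f - 1)) = f / 2.
  by apply: (mulIf fm0); rewrite -[LHS]mulrA divfK //; lra.
move=> m m5; have -> : ((4 + 1 + m) %% 5 = m)%N by lia.
rewrite /bpoint; case: m m5 => [|[|[|[|[|//]]]]] _; rewrite /fan /lin /fan_x /fan_y /=.
- rewrite ifF; last by apply/eqP; lra.
  by congr Some; field.
- rewrite ifF; last by apply/eqP; lra.
  congr Some.
  have -> : (f * 1 + 1 * - 0 - (f * 0 + 1 * - 1)) / (f * 0 + 1 * - 1 + (f * 1 + 1 * - 0)) =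
     (f + 1) / (f - 1) :> R by congr (_ / _); ring.
  by rewrite key.
- by rewrite ifT //; apply/eqP; ring.
- rewrite ifF; last by apply/eqP; lra.
  congr Some.
  have -> : (1 * 1 + f * - 0 - (1 * 0 + f * - 1)) / (1 * 0 + f * - 1 + (1 * 1 + f * - 0)) =
     - ((f + 1) / (f - 1)) :> R by rewrite -mulrN -invrN; congr (_ / _); ring.
  by rewrite mulrN key.
- rewrite ifF; last by apply/eqP; lra.
  by congr Some; field.
Qed.

Lemma third_sector_quadrant x : quadrant2 x -> third_sector (bpoint x) ->
  x.1 = 0 \/ x.2 = 0.
Proof.
case=> x1 x2; rewrite /bpoint; case: eqVneq => //= s0 /andP[h1 h2].
have fb := phi_bounds R; set m := 1 - f / 2 in h2.
have m0 : 0 < m by rewrite /m; lra.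
have {}h1 : - 1 <= (x.2 - x.1) / (x.1 + x.2).
  by rewrite -(ler_pM2l m0) mulrN1 (le_trans _ h1) // /m; lra.
have {h2 m0} h2 : (x.2 - x.1) / (x.1 + x.2) <= 1 by rewrite -(ler_pM2l m0) mulr1.
move: s0; rewrite neq_lt => /orP[s|s].
  by right; rewrite ler_ndivlMr // in h1; lra.
by left; rewrite ler_pdivrMr // mul1r in h2; lra.
Qed.

Lemma quadrant2_fan x y m : quadrant2 x -> quadrant2 y -> (m < 5)%N ->
  quadrant2 (fan m x y).
Proof.
have f0 := phi_gt0 R => -[x1 x2] [y1 y2].
have fx1 : 0 <= f * (- x.1) by rewrite mulr_ge0 ?oppr_ge0 // ltW.
have fy1 : 0 <= f * (- y.1) by rewrite mulr_ge0 ?oppr_ge0 // ltW.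
have fx2 := mulr_ge0 (ltW f0) x2; have fy2 := mulr_ge0 (ltW f0) y2.
by case: m => [|[|[|[|[|//]]]]] _; split; rewrite /fan /lin /fan_x /fan_y /=; lra.
Qed.

(** Otherwise all directions of the fan would be those of e and e', but the fan
    has five directions. *)
Lemma quadrant2_not_third_sector Q (j : 'I_5) x y : framed Q j x y ->
  quadrant2 x -> quadrant2 y -> det2 x y != 0 ->
  ~ (forall i, third_sector (tnth Q i)).
Proof.
move=> F qx qy D ts; have f0 := phi_gt0 R.
have ax m : (m < 5)%N -> (fan m x y).1 = 0 \/ (fan m x y).2 = 0.
  move=> m5; apply: third_sector_quadrant; first exact: quadrant2_fan.
  rewrite -F //; have := ts (Ordinal (ltn_pmod (j + 1 + m) (isT : 0 < 5)%N)).
  by rewrite (tnth_nth None).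
case: qx qy => x1 x2 [y1 y2].
have := ax 0%N isT; have := ax 4%N isT; have := ax 2%N isT.
rewrite fan0 fan4 /fan /lin /fan_x /fan_y /= -!mulrDr.
move: D; rewrite /det2 => D.
have zero (s : R) : f * s = 0 -> s = 0 by move/eqP; rewrite mulf_eq0 gt_eqF //= => /eqP.
move=> h2 h4 h0; apply/negP: D; rewrite negbK.
have {}h2 : x.1 + y.1 = 0 \/ x.2 + y.2 = 0 by case: h2 => /zero; [left|right].
apply/eqP; case: h2 => h2.
  have e1 : x.1 = 0 by lra.
  have e2 : y.1 = 0 by lra.
  by rewrite e1 e2; ring.
have e1 : x.2 = 0 by lra.
have e2 : y.2 = 0 by lra.
by rewrite e1 e2; ring.
Qed.

Lemma side_index (j j' : 'I_5) : j' != j ->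
  exists2 m, (m < 4)%N & val j' = ((j + 1 + m) %% 5)%N.
Proof.
move=> ne; have {}ne : (j' : nat) <> j by move=> e; rewrite (val_inj e) eqxx in ne.
exists ((j' + 4 * (j + 1)) %% 5)%N; have := ltn_ord j; have := ltn_ord j'; rewrite /=; lia.
Qed.

(** Every pentagon but the first lies beyond a side of the first one: beyond the
    side that spans the third sector, or beyond one of the other four. *)
Definition placed (n : nat) x y : Prop :=
  det2 x y != 0 /\ (nested n x y \/ quadrant2 x /\ quadrant2 y).

Lemma placed_child n G (jG j : 'I_5) x y : framed G jG x y -> placed n x y -> j != jG ->
  exists x' y', [/\ framed G j x' (- y'), framed (reflect_pentagon G j) j x' y' &
                    placed n.+1 x' y'].
Proof.
move=> FG [D st] /side_index[m m4 em].
have [F1 F2] := framed_child FG D m4 em.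
exists (fan m.+1 x y), (fan m x y); split=> //; split; first by rewrite det2_fan // oppr_eq0.
case: st => [N|[qx qy]]; [left; exact: nested_fan|right].
by split; apply: quadrant2_fan => //; exact: ltnW.
Qed.

Lemma placed_first (j : 'I_5) : exists x y,
  [/\ framed (pentagon0 R) j x (- y), framed (reflect_pentagon (pentagon0 R) j) j x y &
      placed 0 x y].
Proof.
have F0 := framed_pentagon0.
have D0 : det2 (0, 1) (- (1, 0) : R * R) != 0 by rewrite /det2 /=; apply/eqP; lra.
have [->|/side_index[m m4 em]] := eqVneq j (@Ordinal 5 4 isT).
  have D : det2 (0, 1) (1, 0) != 0 :> R by rewrite /det2 /=; apply/eqP; lra.
  exists (0, 1), (1, 0); split=> //; first exact: framed_reflect.
  by split=> //; left; apply: nested_flip; exact: nested_base.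
have [F1 F2] := framed_child F0 D0 m4 em.
exists (fan m.+1 (0, 1) (- (1, 0))), (fan m (0, 1) (- (1, 0))); split=> //.
split; first by rewrite det2_fan // oppr_eq0.
have q1 : quadrant2 (0, 1) by rewrite /quadrant2 /=; lra.
have q2 : quadrant2 (- (1, 0)) by rewrite /quadrant2 /=; lra.
by right; split; apply: quadrant2_fan => //; exact: ltnW.
Qed.

(** The side shared with the previous generation is the outer side of the frame,
    so the next reflection is in another side. *)
Lemma generation_frame k Q : generation k.+1 Q -> exists F (j : 'I_5) x y,
  [/\ generation k F, Q = reflect_pentagon F j, framed F j x (- y),
      framed Q j x y & placed k x y].
Proof.
elim: k Q => [|k IH] Q [G [j [gG side eQ]]].
  have [x [y [F1 F2 P]]] := placed_first j.
  by exists G, j, x, y; rewrite eQ gG.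
have [F [jG [x [y [gF eG FF FG P]]]]] := IH G gG.
have ne : j != jG.
  apply: contra_notN side => /eqP ->; exists F, jG; split=> //; left.
  have [-> ->] := framed_end FF; have [-> ->] := framed_end FG.
  by rewrite bpointN.
have [x' [y' [F1 F2 P']]] := placed_child FG P ne.
by exists G, j, x', y'; rewrite eQ.
Qed.

Lemma framed_reflectK F (j : 'I_5) x y : framed F j x (- y) -> det2 x y != 0 ->
  reflect_pentagon (reflect_pentagon F j) j = F.
Proof.
move=> FF D; apply: (framed_ext _ FF).
apply: framed_reflect; first by rewrite opprK; exact: framed_reflect.
by move: D; rewrite -oppr_eq0 /det2 /=; congr (_ != 0); ring.
Qed.

(** Reflecting G in its outer side would give back the pentagon F from which G was
    obtained; then Q = F would have depths that differ by two, or Q would be the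
    first pentagon, which has an infinite vertex. *)
Lemma third_sector_frame k G Q (j : 'I_5) : generation k G -> generation k.+1 Q ->
  Q = reflect_pentagon G j -> (forall i, third_sector (tnth Q i)) ->
  exists x y, framed G j x (- y) /\ framed Q j x y /\ nested k x y.
Proof.
move=> gG gQ eQ ts.
have nested_of x y n (j0 : 'I_5) Q0 : Q0 = Q -> framed Q0 j0 x y -> det2 x y != 0 ->
    (nested n x y \/ quadrant2 x /\ quadrant2 y) -> nested n x y.
  by move=> -> F D [//|[qx qy]]; case: (quadrant2_not_third_sector F qx qy D).
case: k gG gQ => [|k] gG gQ.
  have [x [y [F1 F2 [D st]]]] := placed_first j.
  rewrite /= in gG; rewrite -gG in F1 F2; rewrite -eQ in F2.
  by exists x, y; do 2 split=> //; exact: nested_of F2 D st.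
have [F [jG [x [y [gF eG FF FG P]]]]] := generation_frame gG.
have [e|ne] := eqVneq j jG.
  have eF : F = Q.
    by rewrite eQ eG e (framed_reflectK FF) //; case: P.
  case: k gG gQ gF P => [|k] gG gQ gF P.
    by have := ts (@Ordinal 5 2 isT); rewrite -eF gF.
  have [_ [j1 [x1 [y1 [_ _ _ FF1 [D1 st1]]]]]] := generation_frame gF.
  have [_ [j2 [x2 [y2 [_ _ _ FQ2 [D2 st2]]]]]] := generation_frame gQ.
  rewrite eF in FF1.
  have := framed_depth FF1 (nested_of _ _ _ _ _ erefl FF1 D1 st1) FQ2
    (nested_of _ _ _ _ _ erefl FQ2 D2 st2).
  by lia.
have [x' [y' [F1 F2 [D st]]]] := placed_child FG P ne.
rewrite -eQ in F2.
by exists x', y'; do 2 split=> //; exact: nested_of erefl F2 D st.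
Qed.

(** Parallel vectors of the fan have parallel coefficients, as x and y are
    independent, and the five pairs of coefficients are not parallel. *)
Lemma fan_bpoint_inj x y m m' : in_sector x -> in_sector y -> det2 x y != 0 ->
  (m < 5)%N -> (m' < 5)%N -> bpoint (fan m x y) = bpoint (fan m' x y) -> m = m'.
Proof.
move=> nx ny D m5 m5'; rewrite !bpoint_coord; [|exact: fan_sector|exact: fan_sector].
case=> e; have := bcoord_parallel (fan_sector nx ny m5) (fan_sector nx ny m5') e.
have fb := phi_bounds R; have ff := phi_sq R; have f0 := phi_gt0 R.
case=> k k0 [e1 e2].
have h1 : (k * fan_x R m - fan_x R m') * x.1 + (k * fan_y R m - fan_y R m') * y.1 = 0.
  by move: e1; rewrite /fan /lin /=; lra.
have h2 : (k * fan_x R m - fan_x R m') * x.2 + (k * fan_y R m - fan_y R m') * y.2 = 0.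
  by move: e2; rewrite /fan /lin /=; lra.
have cx : k * fan_x R m - fan_x R m' = 0.
  apply: (mulIf D); rewrite mul0r /det2; move: h1 h2; set s := _ - _; set t := _ - _ => h1 h2.
  have -> : s * (x.1 * y.2 - x.2 * y.1) =
    y.2 * (s * x.1 + t * y.1) - y.1 * (s * x.2 + t * y.2) by ring.
  by rewrite h1 h2; ring.
have cy : k * fan_y R m - fan_y R m' = 0.
  apply: (mulIf D); rewrite mul0r /det2; move: h1 h2; set s := _ - _; set t := _ - _ => h1 h2.
  have -> : t * (x.1 * y.2 - x.2 * y.1) =
    x.1 * (s * x.2 + t * y.2) - x.2 * (s * x.1 + t * y.1) by ring.
  by rewrite h1 h2; ring.
have kf := mulr_gt0 k0 f0.
case: m m5 cx cy {e e1 e2 h1 h2} => [|[|[|[|[|//]]]]] _;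
  case: m' m5' => [|[|[|[|[|//]]]]] _; rewrite /fan_x /fan_y //= => cx cy; exfalso; nra.
Qed.

Lemma rot_pentagon Q n : exists2 a, (a < 5)%N &
  rot n Q = [seq nth None Q ((a + i) %% 5) | i <- iota 0 5].
Proof.
case: Q => s /= s5; case: s s5 => [|q0 [|q1 [|q2 [|q3 [|q4 [|]]]]]] //= _.
case: n => [|[|[|[|[|n]]]]]; [exists 0%N|exists 1%N|exists 2|exists 3|exists 4|exists 0%N] => //.
Qed.

(** A list of the vertices that begins and ends with the two ends of the outer side
    runs through the fan from one end to the other. *)
Lemma listed_frame Q (j : 'I_5) x y beta beta' delta1 delta2 delta3 :
  framed Q j x y -> in_sector x -> in_sector y -> det2 x y != 0 ->
  (tnth Q j = beta /\ tnth Q (ordS j) = beta') \/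
  (tnth Q j = beta' /\ tnth Q (ordS j) = beta) ->
  listed_in_order Q [:: beta; delta1; delta2; delta3; beta'] ->
  let l := [:: beta; delta1; delta2; delta3; beta'] in
  l = [seq bpoint (fan m x y) | m <- iota 0 5] \/
  l = [seq bpoint (fan m y x) | m <- iota 0 5].
Proof.
move=> F nx ny D; have [-> ->] := framed_end F.
rewrite -[in bpoint x](fan0 x y) -[in bpoint y](fan4 x y) => ends [n].
have [a a5 ->] := rot_pentagon Q n.
have inj := fan_bpoint_inj nx ny D.
pose k := ((a + 4 * (j + 1)) %% 5)%N.
have k5 : (k < 5)%N by rewrite ltn_pmod.
have entry i : nth None Q ((a + i) %% 5) = bpoint (fan ((k + i) %% 5) x y).
  by rewrite -F ?ltn_pmod //; congr nth; rewrite /k; lia.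
rewrite (eq_map entry) /= => -[[e0 e1 e2 e3 e4]|[e0 e1 e2 e3 e4]].
  rewrite e0 e4 in ends; case: ends => -[h1 h2].
    by have := inj _ _ _ _ h1; have := inj _ _ _ _ h2; rewrite !ltn_pmod //; lia.
  have k0 : k = 0%N.
    by have := inj _ _ _ _ h2; rewrite !ltn_pmod // => /(_ isT isT); lia.
  by left; rewrite e0 e1 e2 e3 e4 k0.
rewrite e0 e4 in ends; case: ends => -[h1 h2]; last first.
  by have := inj _ _ _ _ h1; have := inj _ _ _ _ h2; rewrite !ltn_pmod //; lia.
have k0 : k = 0%N.
  by have := inj _ _ _ _ h2; rewrite !ltn_pmod // => /(_ isT isT); lia.
right; rewrite e0 e1 e2 e3 e4 k0.
by rewrite (@fan_flip R 0 x y) // (@fan_flip R 1 x y) // (@fan_flip R 2 x y) //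
  (@fan_flip R 3 x y) // (@fan_flip R 4 x y).
Qed.

Lemma nested_periods num n x y a A b B : nested n x y ->
  pair_of_periods num (bpoint x) a A -> pair_of_periods num (bpoint y) b B ->
  [/\ pair_of_periods num (bpoint (fan 1 x y)) (b + A) (a + A + B),
      pair_of_periods num (bpoint (fan 2 x y)) (A + B) (a + b + A + B) &
      pair_of_periods num (bpoint (fan 3 x y)) (a + B) (b + A + B)].
Proof.
move=> N; have [nx ny gx gy _] := nested_facts N.
have g m : (m < 4)%N -> decomposes f (fan m x y).
  by move=> m4; have [] := nested_facts (nested_fan N m4).
exact: (pairs_of_periods_combine nx ny gx gy
  (g 1%N isT) (g 2%N isT) (g 3%N isT)).
Qed.

End Generations.

(** * Periods of a new pentagon *)

Local Close Scope ring_scope.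

Theorem theorem2 (R : realType) (num : numeration) (k : nat)
    (G Q : ideal_pentagon R) (j : 'I_5)
    (beta beta' delta1 delta2 delta3 : boundary R) (a A b B : nat) :
  generation k G ->
  is_side G j beta beta' ->
  third_sector beta -> third_sector beta' ->
  generation k.+1 Q ->
  Q = reflect_pentagon G j ->
  (forall i : 'I_5, third_sector (tnth Q i)) ->
  listed_in_order Q [:: beta; delta1; delta2; delta3; beta'] ->
  pair_of_periods num beta a A ->
  pair_of_periods num beta' b B ->
  [/\ pair_of_periods num delta1 (b + A) (a + A + B),
      pair_of_periods num delta2 (A + B) (a + b + A + B) &
      pair_of_periods num delta3 (a + B) (b + A + B)].
Proof.
move=> gG sideG _ _ gQ eQ ts listed pa pb.
have [x [y [FG [FQ N]]]] := third_sector_frame gG gQ eQ ts.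
have [nx ny _ _ d] := nested_facts N.
have D : (det2 x y != 0)%R.
  by apply: contra_eq_neq d => ->; rewrite expr0n eq_sym oner_eq0.
have ends : (tnth Q j = beta /\ tnth Q (ordS j) = beta') \/
            (tnth Q j = beta' /\ tnth Q (ordS j) = beta).
  have [-> ->] := framed_end FQ; have [ey ex] := framed_end FG.
  by move: sideG; rewrite /is_side ey ex bpointN.
have [[eb e1 e2 e3 eb']|[eb e1 e2 e3 eb']] := listed_frame FQ nx ny D ends listed.
  rewrite eb fan0 in pa; rewrite eb' fan4 in pb; rewrite e1 e2 e3.
  exact: (nested_periods N pa pb).
rewrite eb fan0 in pa; rewrite eb' fan4 in pb; rewrite e1 e2 e3.
exact: (nested_periods (nested_flip N) pa pb).
Qed.
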